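(* If a generalized $J$-group $J\binom{K}{K'}$ is infinite, then its nontrivial torsion elements are precisely its finite order reflections.
   Context: For $p\geqslant 1$ and a tuple $K=(k_1,\dots,k_p)$ with entries in $\mathbb{N}_{\geqslant 2}\cup\{\infty\}$, let $J(K)=\langle s_1,\dots,s_p\mid s_1s_2\cdots s_p=s_2\cdots s_ps_1=\cdots=s_ps_1\cdots s_{p-1},\ s_i^{k_i}=1 \text{ for all } i \text{ with } k_i<\infty\rangle$. If $K'=(k'_1,\dots,k'_p)$ is a tuple of positive integers with $k'_i$ dividing $k_i$ for all $i$ (every positive integer divides $\infty$), the generalized $J$-group $J\binom{K}{K'}$ is the normal closure of $\{s_1^{k'_1},\dots,s_p^{k'_p}\}$ in $J(K)$. The reflections of $J\binom{K}{K'}$ are all conjugates in $J(K)$ of those powers of $s_1^{k'_1},\dots,s_p^{k'_p}$ which are different from $1$. *)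

(* Defs.v *)
From HB Require Import structures.
From mathcomp Require Import all_boot.
From mathcomp Require Import mathcomp_extra boolp classical_sets cardinality.

Set Implicit Arguments.
Unset Strict Implicit.
Unset Printing Implicit Defensive.

Local Open Scope group_scope.
Local Open Scope quotient_scope.

(* The letter (i, false) stands for the generator i and (i, true) for its
   formal inverse. *)
Definition word (I : choiceType) : Type := seq (I * bool).
HB.instance Definition _ (I : choiceType) := Choice.on (word I).

Section Presentation.
Variables (I : choiceType) (R : word I -> word I -> Prop).

Inductive word_eq : word I -> word I -> Prop :=
| word_eq_refl u : word_eq u u
| word_eq_sym u v : word_eq u v -> word_eq v u
| word_eq_trans u v w : word_eq u v -> word_eq v w -> word_eq u w
| word_eq_cat u u' v v' :
    word_eq u u' -> word_eq v v' -> word_eq (u ++ v) (u' ++ v')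
| word_eq_cancel i b : word_eq [:: (i, b); (i, ~~ b)] [::]
| word_eq_rel u v : R u v -> word_eq u v.

Definition word_eqb : rel (word I) := fun u v => `[< word_eq u v >].

Lemma word_eqb_refl : reflexive word_eqb.
Proof. by move=> u; apply/asboolP; exact: word_eq_refl. Qed.

Lemma word_eqb_sym : symmetric word_eqb.
Proof. by move=> u v; apply/asboolP/asboolP; exact: word_eq_sym. Qed.

Lemma word_eqb_trans : transitive word_eqb.
Proof.
move=> v u w /asboolP uv /asboolP vw; apply/asboolP.
exact: word_eq_trans uv vw.
Qed.

Canonical word_equiv := EquivRel word_eqb word_eqb_refl word_eqb_sym
  word_eqb_trans.

(* The group < I | u = v for all u, v such that R u v >. *)
Definition presented : Type := {eq_quot word_equiv}.
HB.instance Definition _ := Choice.on presented.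
HB.instance Definition _ := EqQuotient.on presented.

Definition word_inv (u : word I) : word I :=
  rev [seq (x.1, ~~ x.2) | x <- u].

Definition presented_class (u : word I) : presented := \pi_presented u.
Definition presented_mul (x y : presented) : presented :=
  presented_class (repr x ++ repr y).
Definition presented_one : presented := presented_class [::].
Definition presented_inv (x : presented) : presented :=
  presented_class (word_inv (repr x)).

Lemma presented_classP u v :
  presented_class u = presented_class v <-> word_eq u v.
Proof.
split=> [/eqP|uv]; first by rewrite piE /= => /asboolP.
by apply/eqP; rewrite piE /=; apply/asboolP.
Qed.

Lemma repr_presented_class u : word_eq (repr (presented_class u)) u.
Proof. by apply/presented_classP; rewrite /presented_class reprK. Qed.

Lemma presented_mulE u v :
  presented_mul (presented_class u) (presented_class v) =
  presented_class (u ++ v).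
Proof.
by apply/presented_classP; apply: word_eq_cat; exact: repr_presented_class.
Qed.

Lemma word_inv_cat u v : word_inv (u ++ v) = word_inv v ++ word_inv u.
Proof. by rewrite /word_inv map_cat rev_cat. Qed.

Lemma word_invK u : word_inv (word_inv u) = u.
Proof.
rewrite /word_inv map_rev revK -map_comp -[RHS]map_id.
by apply: eq_map => -[i b] /=; rewrite negbK.
Qed.

Lemma word_mulV u : word_eq (u ++ word_inv u) [::].
Proof.
elim: u => [|[i b] u IHu]; first exact: word_eq_refl.
rewrite -cat1s word_inv_cat -catA (catA u).
apply: word_eq_trans (word_eq_cancel i b).
rewrite -[[:: (i, b); _]]/([:: (i, b)] ++ [:: (i, ~~ b)]).
apply: word_eq_cat; first exact: word_eq_refl.
rewrite -[[:: (i, ~~ b)]]cat0s.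
by apply: word_eq_cat IHu _; exact: word_eq_refl.
Qed.

Lemma word_mulVl u : word_eq (word_inv u ++ u) [::].
Proof. by rewrite -{2}(word_invK u); exact: word_mulV. Qed.

Lemma presented_class_repr x : presented_class (repr x) = x.
Proof. exact: reprK. Qed.

Lemma presented_mulA : associative presented_mul.
Proof.
move=> x y z; rewrite -(presented_class_repr x) -(presented_class_repr y).
by rewrite -(presented_class_repr z) !presented_mulE catA.
Qed.

Lemma presented_mul1 : left_id presented_one presented_mul.
Proof.
by move=> x; rewrite -(presented_class_repr x) presented_mulE.
Qed.

Lemma presented_mulr1 : right_id presented_one presented_mul.
Proof.
by move=> x; rewrite -(presented_class_repr x) presented_mulE cats0.
Qed.

Lemma presented_mulVx : left_inverse presented_one presented_inv presented_mul.
Proof.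
move=> x; rewrite -{2}(presented_class_repr x) presented_mulE.
by apply/presented_classP; exact: word_mulVl.
Qed.

Lemma presented_mulxV : right_inverse presented_one presented_inv presented_mul.
Proof.
move=> x; rewrite -{1}(presented_class_repr x) presented_mulE.
by apply/presented_classP; exact: word_mulV.
Qed.

HB.instance Definition _ := isGroup.Build presented
  presented_mulA presented_mul1 presented_mulr1
  presented_mulVx presented_mulxV.

Definition presented_gen (i : I) : presented := presented_class [:: (i, false)].

End Presentation.

Section GroupSets.
Variable G : groupType.
Local Open Scope classical_set_scope.

Definition normal_subgroup (H : set G) : Prop :=
  [/\ H 1, forall x y, H x -> H y -> H (x / y)
    & forall x g, H x -> H (x ^ g)].

Definition normal_closure (S : set G) : set G := smallest normal_subgroup S.

Definition finite_order (x : G) : Prop := exists2 n, 0 < n & x ^+ n = 1.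

End GroupSets.

(* [None] encodes the entry infinity. *)
Definition ge2_or_infty (k : option nat) : bool :=
  if k is Some n then 2 <= n else true.

Definition dvd_or_infty (d : nat) (k : option nat) : bool :=
  if k is Some n then d %| n else true.

Section JGroups.
Variable p : nat.

(* The word s_1 s_2 ... s_p. *)
Definition gen_word : word 'I_p := [seq (i, false) | i <- enum 'I_p].

Variable K : 'I_p -> option nat.

Inductive J_rel : word 'I_p -> word 'I_p -> Prop :=
| J_rel_rot a b : J_rel (rot a gen_word) (rot b gen_word)
| J_rel_order i k : K i = Some k -> J_rel (nseq k (i, false)) [::].

Definition Jgroup : groupType := presented J_rel.

Definition J_gen (i : 'I_p) : Jgroup := presented_gen J_rel i.

Variable K' : 'I_p -> nat.

Definition gen_Jgroup : set Jgroup :=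
  normal_closure (range (fun i => J_gen i ^+ K' i)).

(* Powers have integer exponents, hence the two cases. *)
Definition reflection (x : Jgroup) : Prop :=
  exists (i : 'I_p) (m : nat) (y g : Jgroup),
    [/\ y = (J_gen i ^+ K' i) ^+ m \/ y = (J_gen i ^+ K' i) ^- m,
        y <> 1 & x = y ^ g].

End JGroups.

Arguments gen_Jgroup [p] K K' _.
Arguments reflection [p] K K' x.

(* Main.v *)
(* Let z = s_1 ... s_p, which is central in J(K), and D = J(K) / <z>, so that
   D = < s_1, ..., s_p | s_i ^ k_i, s_1 ... s_p >.

   Suppose first that D is infinite. If T in Z[D] is such that T s_1 ... s_(i-1)
   is right invariant under s_i for every i, then T is right invariant under D,
   and T = 0 since T has finite support. Through Fox calculus this has two
   consequences. A power z ^ n can be a power of s_i in J(K) only if n = 0. And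
   the sequence
     0 -> Z[D] -> (+)_i Z[D] (s_i - 1) -> I -> 0,
   in which I is the augmentation ideal, the first map sends T to the family
   T s_1 ... s_(i-1) (s_i - 1) and the second one is the sum, is exact. By
   dimension shifting, every finite cyclic subgroup C of D then has the same Tate
   cohomology with coefficients in (+)_i Z[D / <s_i>] as with coefficients in Z;
   when C has prime order this forces C to fix exactly one coset of one of the
   <s_i>. Hence every torsion element of D is conjugate into some <s_i>, and
   by the first consequence the same holds in J(K).

   If D is finite while J(K) is infinite, the transfer from J(K) to <z> shows that
   some k_i is infinite; then p <= 2, because D maps onto a group containing a
   translation of the plane otherwise. In that case J(K) is elementary.

   Finally, s_i ^ m can lie in the normal closure of the s_j ^ k'_j only if k'_i
   divides m: look at the exponent sum of s_i modulo k'_i. *)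

Require Import Defs.
From HB Require Import structures.
From mathcomp Require Import all_boot all_order all_algebra all_field.
From mathcomp Require Import mathcomp_extra boolp classical_sets cardinality.
From mathcomp Require Import functions fsbigop zify ring.

Set Implicit Arguments.
Unset Strict Implicit.
Unset Printing Implicit Defensive.

Import GRing.Theory Num.Theory.

(** * Integer powers and cyclic subgroups *)

Section IntPower.
Variable G : groupType.
Implicit Types (h x y : G) (m n : int).
Local Open Scope group_scope.

Definition expgz h n : G :=
  match n with Posz k => h ^+ k | Negz k => h ^- k.+1 end.

(** Writing integers as differences of naturals spares the sign cases in [expgzD]. *)
Lemma expgzB h (a b : nat) : expgz h (a%:Z - b%:Z)%R = h ^+ a / h ^+ b.
Proof.
have [le_ba|lt_ab] := leqP b a; first by rewrite subzn//= expgnFr.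
rewrite -opprB subzn 1?ltnW//.
have -> : h ^+ a / h ^+ b = h ^- (b - a).
  by rewrite expgnFr 1?ltnW// invgM invgK.
have : (0 < b - a)%N by rewrite subn_gt0.
by case: (b - a)%N => // k _; rewrite -NegzE.
Qed.

Lemma int_natB n : exists a b : nat, n = (a%:Z - b%:Z)%R.
Proof.
case: n => k; first by exists k, 0; rewrite subr0.
by exists 0, k.+1; rewrite sub0r -NegzE.
Qed.

Lemma expgzD h m n : expgz h (m + n)%R = expgz h m * expgz h n.
Proof.
have [a [b ->]] := int_natB m; have [c [d ->]] := int_natB n.
rewrite addrACA -opprD -!PoszD !expgzB [(b + d)%N]addnC !expgnDr invgM.
have cV : commute (h ^+ c) (h ^- b) by apply/commuteV/commuteX2.
by rewrite !mulgA -[h ^+ a * h ^+ c * _]mulgA cV !mulgA.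
Qed.

Lemma expgz1 h : expgz h 1 = h. Proof. exact: expg1. Qed.

Lemma expgzN h n : expgz h (- n)%R = (expgz h n)^-1.
Proof. by apply/(mulgI (expgz h n)); rewrite mulgV -expgzD subrr. Qed.

Lemma expgzM h m (k : nat) : expgz h (m * k%:Z)%R = expgz h m ^+ k.
Proof.
elim: k => [|k IHk]; first by rewrite mulr0.
by rewrite -addn1 PoszD mulrDr mulr1 expgzD IHk expgnDr expg1.
Qed.

Lemma commute_expgz x h n : commute x h -> commute x (expgz h n).
Proof. by move=> xh; case: n => k /=; [|apply: commuteV]; apply: commuteX. Qed.

Lemma expgz_closed (A : set G) h n :
  A 1 -> (forall x y, A x -> A y -> A (x * y)) -> (forall x, A x -> A x^-1) ->
  A h -> A (expgz h n).
Proof.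
move=> A1 AM AV Ah.
have AX k : A (h ^+ k) by elim: k => // k IHk; rewrite expgS; apply: AM.
by case: n => k /=; [|apply: AV]; apply: AX.
Qed.

Definition cyc h : set G := [set y | exists n, y = expgz h n].

Lemma cyc1 h : cyc h 1. Proof. by exists 0%R. Qed.
Lemma cyc_id h : cyc h h. Proof. by exists 1%R. Qed.
Lemma cycM h x y : cyc h x -> cyc h y -> cyc h (x * y).
Proof. by move=> [m ->] [n ->]; exists (m + n)%R; rewrite expgzD. Qed.
Lemma cycV h x : cyc h x -> cyc h x^-1.
Proof. by move=> [m ->]; exists (- m)%R; rewrite expgzN. Qed.
Lemma cycX h x k : cyc h x -> cyc h (x ^+ k).
Proof. by move=> [m ->]; exists (m * k%:Z)%R; rewrite expgzM. Qed.

End IntPower.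

(** * The group ring as finitely supported functions *)

Section Chains.
Variable G : groupType.
Local Open Scope ring_scope.
Implicit Types (f w : G -> int) (x h : G).

Definition fin_supp f := exists s : seq G, forall g, g \notin s -> f g = 0.

(** The pairing of a weight with a chain; the weight 1 gives the augmentation. The sum defaults to 0
    when its terms have infinite support, hence the [fin_supp] hypotheses below. *)
Definition wsum w f : int := \sum_(g \in [set: G]) w g * f g.

Definition delta h : G -> int := fun g => (g == h)%:R.
(** With [delta g] as basis element g of the group ring, these are left multiplication by x and
    right multiplication by h; the inverses come from reading off coefficients. *)
Definition ltrans x f : G -> int := fun g => f (x^-1 * g)%g.
Definition rtrans h f : G -> int := fun g => f (g * h^-1)%g.

Let subfunE f f' g : (f - f') g = f g - f' g. Proof. by []. Qed.

Lemma ltrans_is_zmod_morphism x : zmod_morphism (ltrans x).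
Proof. by []. Qed.
HB.instance Definition _ x := GRing.isZmodMorphism.Build (G -> int) (G -> int)
  (ltrans x) (ltrans_is_zmod_morphism x).
Lemma rtrans_is_zmod_morphism h : zmod_morphism (rtrans h).
Proof. by []. Qed.
HB.instance Definition _ h := GRing.isZmodMorphism.Build (G -> int) (G -> int)
  (rtrans h) (rtrans_is_zmod_morphism h).

Lemma ltransM x y f : ltrans (x * y)%g f = ltrans x (ltrans y f).
Proof. by apply/funext => g; rewrite /ltrans invgM mulgA. Qed.

Lemma rtransM x y f : rtrans (x * y)%g f = rtrans y (rtrans x f).
Proof. by apply/funext => g; rewrite /rtrans invgM mulgA. Qed.

Lemma ltrans_rtrans x h f : ltrans x (rtrans h f) = rtrans h (ltrans x f).
Proof. by apply/funext => g; rewrite /rtrans /ltrans mulgA. Qed.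

Lemma ltrans1 f : ltrans 1%g f = f.
Proof. by apply/funext => g; rewrite /ltrans invg1 mul1g. Qed.

Lemma rtrans1 f : rtrans 1%g f = f.
Proof. by apply/funext => g; rewrite /rtrans invg1 mulg1. Qed.

Lemma ltrans_delta x h : ltrans x (delta h) = delta (x * h)%g.
Proof.
by apply/funext => g; rewrite /ltrans /delta -(inj_eq (mulgI x)) mulVKg.
Qed.

Lemma rtrans_delta x h : rtrans x (delta h) = delta (h * x)%g.
Proof.
by apply/funext => g; rewrite /rtrans /delta -(inj_eq (mulIg x)) mulgVK.
Qed.

Lemma fin_supp0 : fin_supp 0. Proof. by exists [::]. Qed.

Lemma fin_suppB f f' : fin_supp f -> fin_supp f' -> fin_supp (f - f').
Proof.
move=> [s fs] [s' fs']; exists (s ++ s') => g.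
by rewrite mem_cat negb_or subfunE => /andP[/fs -> /fs' ->].
Qed.

Lemma fin_suppN f : fin_supp f -> fin_supp (- f).
Proof. by rewrite -sub0r; apply: fin_suppB; exact: fin_supp0. Qed.

Lemma fin_suppD f f' : fin_supp f -> fin_supp f' -> fin_supp (f + f').
Proof. by move=> ff /fin_suppN; rewrite -{2}[f']opprK; exact: fin_suppB. Qed.

Lemma fin_supp_sum (I : Type) (r : seq I) (P : pred I) (F : I -> G -> int) :
  (forall i, P i -> fin_supp (F i)) -> fin_supp (\sum_(i <- r | P i) F i).
Proof.
by move=> FF; elim/big_ind: _ => //; [exact: fin_supp0|exact: fin_suppD].
Qed.

Lemma fin_supp_mul w f : fin_supp f -> fin_supp (fun g => w g * f g).
Proof. by move=> [s fs]; exists s => g /fs ->; rewrite mulr0. Qed.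

Lemma fin_supp_delta h : fin_supp (delta h).
Proof. by exists [:: h] => g; rewrite inE /delta => /negbTE ->. Qed.

Lemma fin_supp_ltrans x f : fin_supp f -> fin_supp (ltrans x f).
Proof.
move=> [s fs]; exists [seq (x * g)%g | g <- s] => g gs; apply: fs.
by apply: contra gs => gs; apply/mapP; exists (x^-1 * g)%g; rewrite ?mulVKg.
Qed.

Lemma fin_supp_rtrans x f : fin_supp f -> fin_supp (rtrans x f).
Proof.
move=> [s fs]; exists [seq (g * x)%g | g <- s] => g gs; apply: fs.
by apply: contra gs => gs; apply/mapP; exists (g * x^-1)%g; rewrite ?mulgVK.
Qed.

Lemma wsumE w f s : uniq s -> (forall g, g \notin s -> f g = 0) ->
  wsum w f = \sum_(g <- s) w g * f g.
Proof.
move=> us fs; rewrite /wsum (fsbigE s)//; last by move=> g _ /fs ->; rewrite mulr0.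
by apply: eq_bigl => g; rewrite in_setT.
Qed.

Lemma wsumB w f f' : fin_supp f -> fin_supp f' ->
  wsum w (f - f') = wsum w f - wsum w f'.
Proof.
move=> [s fs] [s' fs']; pose r := undup (s ++ s').
have [fr fr'] : (forall g, g \notin r -> f g = 0) /\ (forall g, g \notin r -> f' g = 0).
  by split=> g; rewrite mem_undup mem_cat negb_or => /andP[/fs ? /fs' ?].
rewrite !(@wsumE _ _ r) ?undup_uniq//; last first.
  by move=> g gr; rewrite subfunE fr// fr'// subr0.
by rewrite -sumrB; apply: eq_bigr => g _; rewrite subfunE mulrBr.
Qed.

Lemma wsum0 w : wsum w 0 = 0.
Proof. by rewrite (@wsumE _ _ [::])// big_nil. Qed.

Lemma wsumN w f : fin_supp f -> wsum w (- f) = - wsum w f.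
Proof.
by move=> ff; rewrite -sub0r wsumB ?wsum0 ?sub0r//; exact: fin_supp0.
Qed.

Lemma wsumD w f f' : fin_supp f -> fin_supp f' ->
  wsum w (f + f') = wsum w f + wsum w f'.
Proof.
move=> ff ff'; rewrite -{1}[f']opprK wsumB ?wsumN ?opprK//; exact: fin_suppN.
Qed.

Lemma wsum_sum (I : Type) w (r : seq I) (F : I -> G -> int) :
  (forall i, fin_supp (F i)) ->
  wsum w (\sum_(i <- r) F i) = \sum_(i <- r) wsum w (F i).
Proof.
move=> FF; elim: r => [|i r IHr]; first by rewrite !big_nil wsum0.
by rewrite !big_cons wsumD ?IHr//; exact: fin_supp_sum.
Qed.

Lemma wsum_suml (I : Type) (r : seq I) (W : I -> G -> int) f : fin_supp f ->
  wsum (\sum_(i <- r) W i) f = \sum_(i <- r) wsum (W i) f.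
Proof.
move=> [s fs]; have fu g : g \notin undup s -> f g = 0 by rewrite mem_undup => /fs.
rewrite (wsumE _ (undup_uniq s) fu).
under [RHS]eq_bigr do rewrite (wsumE _ (undup_uniq s) fu).
rewrite exchange_big; apply: eq_bigr => g _.
by rewrite fct_sumE mulr_suml.
Qed.

Lemma wsum_delta w h : wsum w (delta h) = w h.
Proof.
rewrite (@wsumE _ _ [:: h])//; last by move=> g; rewrite inE /delta => /negbTE ->.
by rewrite big_seq1 /delta eqxx mulr1.
Qed.

Lemma wsum_deltal f h : wsum (fun g => delta g h) f = f h.
Proof.
rewrite -(wsum_delta f h); apply: eq_fsbigr => g _.
by rewrite mulrC /delta eq_sym.
Qed.

Lemma wsum_ltrans w x f : wsum w (ltrans x f) = wsum (fun g => w (x * g)%g) f.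
Proof.
rewrite /wsum (reindex_fsbigT (fun g => x * g)%g).
  by apply: eq_fsbigr => g _; rewrite /ltrans mulKg.
by exists (fun g => x^-1 * g)%g => g; rewrite ?mulKg ?mulVKg.
Qed.

Lemma wsum_rtrans w x f : wsum w (rtrans x f) = wsum (fun g => w (g * x)%g) f.
Proof.
rewrite /wsum (reindex_fsbigT (fun g => g * x)%g).
  by apply: eq_fsbigr => g _; rewrite /rtrans mulgK.
by exists (fun g => g * x^-1)%g => g; rewrite ?mulgK ?mulgVK.
Qed.

End Chains.

(** * Actions of a finite cyclic group by left translation *)

Section CyclicAction.
Variables (G : groupType) (x : G) (n : nat).
Local Open Scope ring_scope.
Implicit Types (f T U : G -> int) (g h : G).
Hypotheses (n_gt0 : (0 < n)%N) (xn1 : (x ^+ n)%g = 1%g).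

(** Left multiplication by x - 1 and by the norm 1 + x + ... + x^(n-1), whose alternation computes
    the Tate cohomology of <x>; [rdiff h] is right multiplication by h - 1 and commutes with
    both. *)
Definition ldiff f := ltrans x f - f.
Definition lnorm f := \sum_(j < n) ltrans (x ^+ j)%g f.
Definition rdiff h f := rtrans h f - f.

Lemma ldiff_is_zmod_morphism : zmod_morphism ldiff.
Proof. by move=> f f'; rewrite /ldiff raddfB !opprB [f' - f]addrC addrACA [- _ + f']addrC. Qed.
HB.instance Definition _ := GRing.isZmodMorphism.Build (G -> int) (G -> int)
  ldiff ldiff_is_zmod_morphism.
Lemma lnorm_is_zmod_morphism : zmod_morphism lnorm.
Proof.
by move=> f f'; rewrite /lnorm -sumrB; apply: eq_bigr => j _; rewrite raddfB.
Qed.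
HB.instance Definition _ := GRing.isZmodMorphism.Build (G -> int) (G -> int)
  lnorm lnorm_is_zmod_morphism.
Lemma rdiff_is_zmod_morphism h : zmod_morphism (rdiff h).
Proof. by move=> f f'; rewrite /rdiff raddfB !opprB [f' - f]addrC addrACA [- _ + f']addrC. Qed.
HB.instance Definition _ h := GRing.isZmodMorphism.Build (G -> int) (G -> int)
  (rdiff h) (rdiff_is_zmod_morphism h).

Lemma ldiffB f f' : ldiff (f - f') = ldiff f - ldiff f'.
Proof. exact: raddfB. Qed.
Lemma rdiffB h f f' : rdiff h (f - f') = rdiff h f - rdiff h f'.
Proof. exact: raddfB. Qed.
Lemma rdiffD h f f' : rdiff h (f + f') = rdiff h f + rdiff h f'.
Proof. exact: raddfD. Qed.
Lemma ltrans_rdiff y h f : ltrans y (rdiff h f) = rdiff h (ltrans y f).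
Proof. by rewrite /rdiff raddfB /= ltrans_rtrans. Qed.

Lemma ldiff_rtrans h f : ldiff (rtrans h f) = rtrans h (ldiff f).
Proof. by rewrite /ldiff raddfB ltrans_rtrans. Qed.
Lemma lnorm_rtrans h f : lnorm (rtrans h f) = rtrans h (lnorm f).
Proof.
by rewrite /lnorm raddf_sum; apply: eq_bigr => j _; rewrite ltrans_rtrans.
Qed.
Lemma ldiff_rdiff h f : ldiff (rdiff h f) = rdiff h (ldiff f).
Proof. by rewrite [in LHS]/rdiff [LHS]raddfB /= ldiff_rtrans. Qed.
Lemma lnorm_rdiff h f : lnorm (rdiff h f) = rdiff h (lnorm f).
Proof. by rewrite [in LHS]/rdiff [LHS]raddfB /= lnorm_rtrans. Qed.

Lemma ltrans_lnorm f : ltrans x (lnorm f) = lnorm f.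
Proof.
rewrite /lnorm raddf_sum /=; under eq_bigr do rewrite -ltransM -expgS.
have := telescope_sumr (fun j => ltrans (x ^+ j)%g f) (leq0n n).
rewrite xn1 expg0 subrr sumrB => /eqP; rewrite subr_eq0 => /eqP.
by rewrite !big_mkord.
Qed.

Lemma ldiff_lnorm f : ldiff (lnorm f) = 0.
Proof. by rewrite /ldiff ltrans_lnorm subrr. Qed.
Lemma lnorm_ldiff f : lnorm (ldiff f) = 0.
Proof.
rewrite -(ldiff_lnorm f) /ldiff raddfB /=; congr (_ - _).
rewrite /lnorm raddf_sum /=; apply: eq_bigr => j _.
by rewrite -!ltransM -expgS expgSr.
Qed.

Lemma fin_supp_ldiff f : fin_supp f -> fin_supp (ldiff f).
Proof. by move=> ff; apply: fin_suppB => //; exact: fin_supp_ltrans. Qed.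
Lemma fin_supp_lnorm f : fin_supp f -> fin_supp (lnorm f).
Proof. by move=> ff; apply: fin_supp_sum => j _; exact: fin_supp_ltrans. Qed.
Lemma fin_supp_rdiff h f : fin_supp f -> fin_supp (rdiff h f).
Proof. by move=> ff; apply: fin_suppB => //; exact: fin_supp_rtrans. Qed.

Lemma wsum_rdiff (w : G -> int) h f : (forall g, w (g * h)%g = w g) ->
  fin_supp f -> wsum w (rdiff h f) = 0.
Proof.
move=> wh ff; rewrite wsumB//; last exact: fin_supp_rtrans.
by rewrite wsum_rtrans (_ : (fun g => _) = w) ?subrr//; apply/funext.
Qed.

Lemma wsum_lnorm (w : G -> int) f : (forall g, w (x * g)%g = w g) ->
  fin_supp f -> wsum w (lnorm f) = n%:Z * wsum w f.
Proof.
move=> wx ff; rewrite wsum_sum => [|j]; last exact: fin_supp_ltrans.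
rewrite (eq_bigr (fun=> wsum w f)) => [|j _]; last first.
  rewrite wsum_ltrans; congr (wsum _ f); apply/funext => g.
  by elim: (j : nat) => [|k IHk]; rewrite ?mul1g// expgS -mulgA wx.
by rewrite sumr_const card_ord -mulr_natl natz.
Qed.

Let expgMn1 k : (x ^+ (k * n) = 1)%g.
Proof. by rewrite mulnC expgnA xn1 expg1n. Qed.

(* If the powers of x act freely on the cosets of <h>, then [phi] is the
   indicator function of a union of cosets meeting each <x>-orbit of cosets once. *)
Lemma cyclic_section h :
  (forall g j, (0 < j < n)%N -> ~ cyc h (g^-1 * x ^+ j * g)%g) ->
  exists phi : G -> int, (forall g, phi (g * h)%g = phi g) /\
    (forall g, \sum_(j < n) phi ((x ^+ j)^-1 * g)%g = 1).
Proof.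
move=> free.
(* [orb g] is the double coset <x> g <h>, and [tau] picks one representative in each. The function
   sought is the indicator of the cosets of <h> through these representatives. *)
pose orb g : set G := [set k | exists j c, cyc h c /\ k = (x ^- j * g * c)%g]%classic.
have orbR g c : cyc h c -> orb (g * c)%g = orb g.
  move=> hc; apply/seteqP; split=> k [j [d [hd ->]]].
    by exists j, (c * d)%g; split; [exact: cycM|rewrite !mulgA].
  exists j, (c^-1 * d)%g; split; first by apply: cycM => //; exact: cycV.
  by rewrite !mulgA mulgK.
have orbL g i : orb (x ^- i * g)%g = orb g.
  apply/seteqP; split=> k [j [d [hd ->]]].
    by exists (i + j)%N, d; split=> //; rewrite expgnDr invgM !mulgA.
  (* As x^n = 1, the factor x^(-i(n-1)) cancels the extra x^(-i). *)
  exists (j + i * n.-1)%N, d; split=> //; rewrite !mulgA -invgM -expgnDr.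
  by rewrite addnCA -mulnS prednK// expgnDr expgMn1 mulg1.
pose tau g := xget 1%g (orb g).
have tauP g : orb g (tau g).
  apply: xgetPex; exists g; exists 0%N, 1%g; split; first exact: cyc1.
  by rewrite expg0 invg1 mul1g mulg1.
exists (fun g => if `[< cyc h ((tau g)^-1 * g)%g >] then 1 else 0); split=> g.
  have -> : tau (g * h)%g = tau g by rewrite /tau orbR//; exact: cyc_id.
  congr (if _ then _ else _); apply/asbool_equiv_eq; split=> hg.
    by rewrite -(mulgK h (_ * g)%g) -(mulgA _ g h); apply: cycM => //; apply/cycV/cyc_id.
  by rewrite mulgA; apply: cycM => //; exact: cyc_id.
have tauE j : tau (x ^- j * g)%g = tau g by rewrite /tau orbL.
(* The representative is x^(-i) g c with c in <h>, so reducing i modulo n gives a translate of g in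
   the marked coset. Two such translates would make some x^k with 0 < k < n fix a coset, against
   [free]. *)
have [i [c [hc tE]]] := tauP g.
have xmod : (x ^+ (i %% n) = x ^+ i)%g.
  by rewrite {2}(divn_eq i n) expgnDr expgMn1 mul1g.
pose i0 := Ordinal (ltn_pmod i n_gt0).
have hi0 : cyc h ((tau g)^-1 * (x ^- i0 * g))%g.
  by rewrite tE /= xmod invgM mulgVK; exact: cycV.
rewrite (bigD1 i0)//= tauE asboolT// big1 ?addr0// => j ji0.
rewrite tauE asboolF// => hj.
have key (a b : 'I_n) : (a < b)%N -> cyc h ((tau g)^-1 * (x ^- a * g))%g ->
    cyc h ((tau g)^-1 * (x ^- b * g))%g -> False.
  move=> ab ha hb; apply: (free g (b - a)%N).
    by rewrite subn_gt0 ab (leq_ltn_trans (leq_subr _ _)).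
  have := cycM (cycV hb) ha; rewrite !invgM !invgK -!mulgA mulVKg.
  by rewrite expgnFr ?(ltnW ab)// !mulgA.
have /eqP := ji0; have [/key|/key|/val_inj//] := ltngtP j i0.
  by move=> /(_ hj hi0).
by move=> /(_ hi0 hj).
Qed.

End CyclicAction.

(** * Vanishing of the Tate cohomology of the group ring *)

Section FreeAction.
Variables (G : groupType) (x : G) (n : nat).
Local Open Scope ring_scope.
Implicit Types (f T U : G -> int) (g h : G).
Hypotheses (n_gt0 : (0 < n)%N) (xn1 : (x ^+ n)%g = 1%g).
Hypothesis x_order : forall j, (0 < j < n)%N -> (x ^+ j)%g <> 1%g.

Lemma cyc_one (h : G) : cyc 1%g h -> h = 1%g.
Proof. by move=> [[k|k] ->] /=; rewrite expg1n ?invg1. Qed.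

Lemma free_section : exists phi : G -> int,
  forall g, \sum_(j < n) phi ((x ^+ j)^-1 * g)%g = 1.
Proof.
have [|phi [_ phiP]] := @cyclic_section _ x n n_gt0 xn1 1%g; last by exists phi.
move=> g j jn /cyc_one; rewrite -mulgA -conjgE => /eqP.
by rewrite conjg_eq1 => /eqP; exact: x_order.
Qed.

(** Multiplying an x-invariant chain by [phi], whose translates under <x> sum to 1, gives a chain
    with that norm. *)
Lemma ldiff_eq0 T : fin_supp T -> ldiff x T = 0 ->
  exists2 U, fin_supp U & T = lnorm x n U.
Proof.
move=> Tfin /eqP; rewrite subr_eq0 => /eqP xT.
have [phi phi1] := free_section.
exists (fun g => phi g * T g); first exact: fin_supp_mul.
have xjT j : ltrans (x ^+ j)%g T = T.
  by elim: j => [|j IHj]; rewrite ?ltrans1// expgS ltransM IHj.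
apply/funext => g; rewrite /lnorm fct_sumE -[LHS]mul1r -(phi1 g) mulr_suml.
by apply: eq_bigr => j _; rewrite /ltrans -{1}(xjT j).
Qed.

Lemma lnorm_eq0 T : fin_supp T -> lnorm x n T = 0 ->
  exists2 U, fin_supp U & T = ldiff x U.
Proof.
move=> Tfin NT0; have [phi phi1] := free_section.
(* On [x ^ j * t], with [phi t = 1], the primitive of [T] is minus the sum of [T]
   over [t, ..., x ^ j * t]. *)
pose F j g := phi ((x ^+ j)^-1 * g)%g.
pose S j g : int := \sum_(m < j) T ((x ^+ m)^-1 * g)%g.
have SS j g : S j.+1 (x^-1 * g)%g = S j.+2 g - T g.
  rewrite /S [in RHS]big_ord_recl /= expg0 invg1 mul1g addrC addKr.
  by apply: eq_bigr => m _; rewrite mulgA -invgM -expgS.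
have FS j g : F j (x^-1 * g)%g = F j.+1 g by rewrite /F mulgA -invgM -expgS.
have Sfin j : fin_supp (S j).
  have -> : S j = \sum_(m < j) ltrans (x ^+ m)%g T by apply/funext => g; rewrite fct_sumE.
  by apply: fin_supp_sum => m _; apply: fin_supp_ltrans.
exists (- \sum_(j < n) (fun g => F j g * S j.+1 g)).
  by apply/fin_suppN/fin_supp_sum => j _; apply: fin_supp_mul.
apply/funext => g.
pose V j := F j g * (S j.+1 g - T g).
transitivity (- \sum_(j < n) V j.+1 + \sum_(j < n) F j g * S j.+1 g); last first.
  rewrite /ldiff /ltrans.
  rewrite -[RHS]/(- (\sum_(j < n) (fun g => F j g * S j.+1 g)) (x^-1 * g)%g
    - - (\sum_(j < n) (fun g => F j g * S j.+1 g)) g).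
  rewrite !fct_sumE opprK; congr (- _ + _); apply: eq_bigr => j _.
  by rewrite FS SS.
have -> : \sum_(j < n) F j g * S j.+1 g = \sum_(j < n) V j + T g.
  rewrite -[T g]mul1r -(phi1 g) mulr_suml -big_split; apply: eq_bigr => j _.
  by rewrite /V mulrBr /= -/(F j g) addrNK.
(* The two sums differ by V n - V 0. Here V 0 = 0 because S 1 = T, and V n = 0 because S n is the
   vanishing norm and x^n = 1. *)
suff -> : \sum_(j < n) V j.+1 = \sum_(j < n) V j by rewrite addKr.
apply/eqP; rewrite -subr_eq0.
have := telescope_sumr V (leq0n n); rewrite sumrB !big_mkord => ->.
have -> : V 0%N = 0 by rewrite /V /S big_ord1 expg0 invg1 mul1g subrr mulr0.
have Sn : S n g = 0 by rewrite -[RHS]/((0 : G -> int) g) -NT0 /lnorm fct_sumE.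
by rewrite /V /S big_ord_recr /= -/(S n g) Sn xn1 invg1 mul1g add0r subrr mulr0 subrr.
Qed.

End FreeAction.

(** * Torsion in groups with a short resolution *)

Lemma int_mul_neq1 (n : nat) (k : int) : (1 < n)%N -> (1 <> n%:Z * k)%R.
Proof.
move=> n_gt1 /(congr1 absz); rewrite abszM absz_nat => /esym/eqP.
by rewrite muln_eq1 => /andP[/eqP n1 _]; rewrite n1 in n_gt1.
Qed.

(** By Bezout, j is invertible modulo the prime q. *)
Lemma expg_coprime (G : groupType) (x : G) (q j : nat) :
  prime q -> (x ^+ q = 1)%g -> (0 < j < q)%N -> exists a, (x = x ^+ j ^+ a)%g.
Proof.
move=> q_pr xq1 /andP[j_gt0 jq].
have [a b ab _] := egcdnP q j_gt0.
have /eqP jq1 : coprime j q.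
  by rewrite coprime_sym prime_coprime//; apply/negP => /dvdn_leq; lia.
exists a; rewrite -expgnA mulnC ab jq1 expgnDr mulnC expgnA xq1 expg1n.
by rewrite mul1g expg1.
Qed.

Section Torsion.
Variables (G : groupType) (p : nat) (s P : 'I_p -> G).
Local Open Scope ring_scope.
Implicit Types (T U : G -> int) (a : 'I_p -> G -> int) (x g : G).

(* [P i] plays the role of the prefix s_1 ... s_(i-1). *)
Definition bd i T := rdiff (s i) (rtrans (P i) T).

Lemma bd_is_zmod_morphism i : zmod_morphism (bd i).
Proof. by move=> T U; rewrite /bd !raddfB. Qed.
HB.instance Definition _ i := GRing.isZmodMorphism.Build (G -> int) (G -> int)
  (bd i) (bd_is_zmod_morphism i).

(** With I the augmentation ideal, these four hypotheses express the exactness of 0 -> Z[G] -> (+)_i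
    Z[G] (s_i - 1) -> I -> 0: in turn, exactness in the middle, injectivity, vanishing of the
    composite, and surjectivity. *)
Hypothesis rdiff_exact : forall a, (forall i, fin_supp (a i)) ->
  \sum_i rdiff (s i) (a i) = 0 ->
  exists2 T, fin_supp T & forall i, rdiff (s i) (a i) = bd i T.
Hypothesis bd_inj : forall T, fin_supp T -> (forall i, bd i T = 0) -> T = 0.
Hypothesis sum_bd : forall T, \sum_i bd i T = 0.
Hypothesis delta_gen : forall g, exists2 a : 'I_p -> G -> int, (forall i, fin_supp (a i)) &
  delta g - delta 1%g = \sum_i rdiff (s i) (a i).

Lemma ldiff_bd x i T : ldiff x (bd i T) = bd i (ldiff x T).
Proof. by rewrite /bd ldiff_rdiff ldiff_rtrans. Qed.

Lemma lnorm_bd x n i T : lnorm x n (bd i T) = bd i (lnorm x n T).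
Proof. by rewrite /bd lnorm_rdiff lnorm_rtrans. Qed.

Lemma prime_order_fixes_coset x q : prime q -> (x ^+ q)%g = 1%g -> x <> 1%g ->
  exists i g, cyc (s i) (g^-1 * x * g)%g.
Proof.
move=> q_pr xq1 x_neq1; apply: contrapT => nofix.
(* The class of 1 in the Tate cohomology of <x> with coefficients in Z is shifted
   to the cosets: 1 is the sum of the augmentations of the [u i] modulo [q], and
   each of these vanishes modulo [q] if <x> fixes no coset of <s_i>. *)
have q_gt0 := prime_gt0 q_pr.
have x_ord j : (0 < j < q)%N -> (x ^+ j)%g <> 1%g.
  move=> /(expg_coprime q_pr xq1)[b xE] xj1.
  by apply: x_neq1; rewrite xE xj1 expg1n.
have free i g j : (0 < j < q)%N -> ~ cyc (s i) (g^-1 * x ^+ j * g)%g.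
  move=> /(expg_coprime q_pr xq1)[b xE] /(@cycX _ _ _ b) hx.
  by apply: nofix; exists i, g; move: hx; rewrite -!mulgA -!conjgE -conjXg -xE.
(* [a] lifts x - 1 to the middle term. The norm kills x - 1, so the norm of the lift comes from some
   T in Z[G]. *)
have [a afin aE] := delta_gen x.
have [T Tfin TE] : exists2 T, fin_supp T & forall i, rdiff (s i) (lnorm x q (a i)) = bd i T.
  apply: rdiff_exact => [i|]; first exact: fin_supp_lnorm.
  under eq_bigr do rewrite -lnorm_rdiff.
  rewrite -raddf_sum -aE -[x in delta x]mulg1 -ltrans_delta /=.
  exact: lnorm_ldiff.
have [U Ufin UE] : exists2 U, fin_supp U & T = lnorm x q U.
  apply: ldiff_eq0 => //; apply: bd_inj; first exact: fin_supp_ldiff.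
  by move=> i; rewrite -ldiff_bd -TE -lnorm_rdiff ldiff_lnorm.
(* Correcting the lift by the image of U keeps its sum x - 1 and makes its norm 0, so every
   component has the form (x - 1) u_i. *)
pose m i := rdiff (s i) (a i) - bd i U.
have mE i : m i = rdiff (s i) (a i - rtrans (P i) U) by rewrite raddfB.
have bfin i : fin_supp (a i - rtrans (P i) U).
  by apply: fin_suppB => //; apply: fin_supp_rtrans.
have uex i : exists ui : G -> int, fin_supp ui /\ m i = ldiff x ui.
  have [||ui uifin uiE] := @lnorm_eq0 _ x q q_gt0 xq1 x_ord (m i); last by exists ui.
  - by rewrite mE; apply: fin_supp_rdiff.
  - by rewrite raddfB /= lnorm_bd -UE lnorm_rdiff TE subrr.
have [u uP] := choice uex.
(* Left multiplication by x - 1 sends both 1 and the sum of the [u i] to x - 1; their difference is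
   invariant, hence a norm. *)
have [y yfin yE] : exists2 y, fin_supp y & delta 1%g - \sum_i u i = lnorm x q y.
  apply: (ldiff_eq0 q_gt0 xq1 x_ord).
    apply: fin_suppB; first exact: fin_supp_delta.
    by apply: fin_supp_sum => i _; case: (uP i).
  rewrite raddfB raddf_sum /= {1}/ldiff ltrans_delta mulg1 aE.
  have -> : \sum_i ldiff x (u i) = \sum_i m i by apply: eq_bigr => i _; case: (uP i).
  by rewrite [X in _ - X]sumrB sum_bd subr0 subrr.
have /(congr1 (wsum (fun=> 1))) := yE.
(* The weights [W j] are right invariant under s_i, so they vanish on (x - 1) u_i and hence all take
   the same value on u_i. They sum to 1, so the augmentation of u_i is q times that value. *)
have uq i : exists c : int, wsum (fun=> 1) (u i) = q%:Z * c.
  have [phi [phiR phi1]] := cyclic_section q_gt0 xq1 (free i).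
  exists (wsum phi (u i)); have [ufin uE] := uP i.
  pose W (j : nat) : G -> int := fun g => phi ((x ^+ j)^-1 * g)%g.
  have WE j : wsum (W j) (u i) = wsum phi (u i).
    elim: j => [|j IHj].
      by congr (wsum _ _); apply/funext => g; rewrite /W invg1 mul1g.
    have : wsum (W j.+1) (m i) = 0.
      by rewrite mE wsum_rdiff// => g; rewrite /W mulgA phiR.
    rewrite uE wsumB ?wsum_ltrans//; last exact: fin_supp_ltrans.
    move=> /eqP; rewrite subr_eq0 => /eqP <-; rewrite -IHj.
    by congr (wsum _ _); apply/funext => g; rewrite /W expgS invgM -mulgA mulKg.
  have -> : (fun=> 1) = \sum_(j < q) W j by apply/funext => g; rewrite fct_sumE phi1.
  rewrite wsum_suml// (eq_bigr (fun=> wsum phi (u i))) => [|j _]; last exact: WE.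
  by rewrite sumr_const card_ord -mulr_natl natz.
have [c cE] := choice uq.
rewrite wsumB; first last.
- by apply: fin_supp_sum => i _; case: (uP i).
- exact: fin_supp_delta.
rewrite wsum_delta wsum_sum => [|i]; last by case: (uP i).
rewrite (eq_bigr (fun i => q%:Z * c i)) => [|i _]; last exact: cE.
rewrite -mulr_sumr wsum_lnorm// => /eqP; rewrite subr_eq -mulrDr => /eqP.
by move=> /int_mul_neq1; apply; exact: prime_gt1.
Qed.

Lemma fixed_coset_unique x n i j g h : (1 < n)%N -> (x ^+ n)%g = 1%g ->
  (forall k, (0 < k < n)%N -> (x ^+ k)%g <> 1%g) ->
  cyc (s i) (g^-1 * x * g)%g -> cyc (s j) (h^-1 * x * h)%g ->
  i = j /\ cyc (s j) (h^-1 * g)%g.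
Proof.
move=> n_gt1 xn1 x_ord hg hh; apply: contrapT => distinct.
(* The difference of the two fixed cosets has augmentation 0, so by the same
   shifting it is a norm; but the value of a norm at a fixed coset is divisible
   by [n]. *)
have n_gt0 : (0 < n)%N by exact: ltnW.
(* If x fixes the coset of k, then x k = k s_l^m, so (x - 1) k lies in Z[G] (s_l - 1). *)
have cyc_rdiff l k : cyc (s l) (k^-1 * x * k)%g ->
    exists2 b, fin_supp b & ldiff x (delta k) = rdiff (s l) b.
  rewrite /ldiff ltrans_delta; move=> [m mE].
  have -> : (x * k = k * expgz (s l) m)%g by rewrite -mE -!mulgA mulVKg.
  (* Quantifying over all k makes this set closed under products and inverses. *)
  pose A : set G := [set c | forall k, exists2 b, fin_supp b &
    delta (k * c)%g - delta k = rdiff (s l) b]%classic.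
  apply: (@expgz_closed _ A) => {x k hg hh xn1 x_ord m mE distinct}.
  - by move=> k; exists 0; rewrite ?mulg1 ?subrr ?raddf0//; exact: fin_supp0.
  - move=> c d hc hd k; have [b bfin bE] := hc k; have [b' b'fin b'E] := hd (k * c)%g.
    exists (b' + b); first exact: fin_suppD.
    by rewrite raddfD /= -b'E -bE mulgA addrA subrK.
  - move=> c hc k; have [b bfin bE] := hc (k * c^-1)%g.
    exists (- b); first exact: fin_suppN.
    by rewrite raddfN /= -bE mulgVK opprB.
  - move=> k; exists (delta k); first exact: fin_supp_delta.
    by rewrite /rdiff rtrans_delta.
have [b bfin bE] := cyc_rdiff _ _ hg; have [b' b'fin b'E] := cyc_rdiff _ _ hh.
have [a1 a1fin a1E] := delta_gen g; have [a2 a2fin a2E] := delta_gen h.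
have [a afin aE] : exists2 a : 'I_p -> G -> int, (forall l, fin_supp (a l)) &
    delta h - delta g = \sum_l rdiff (s l) (a l).
  exists (fun l => a2 l - a1 l) => [l|]; first exact: fin_suppB.
  under eq_bigr do rewrite raddfB.
  by rewrite sumrB -a1E -a2E opprB addrA subrK.
pose pick (l i : 'I_p) (f : G -> int) := if l == i then f else 0.
have pickfin l l' f : fin_supp f -> fin_supp (pick l l' f).
  by rewrite /pick; case: eqP => // _ _; exact: fin_supp0.
(* [om] is h in component j minus g in component i, minus a lift of h - g, so its components sum to
   0. Multiplied by x - 1, its components lie in Z[G] (s_l - 1), as witnessed by [c]. *)
pose om l := pick l j (delta h) - pick l i (delta g) - rdiff (s l) (a l).
have omfin l : fin_supp (om l).
  by apply: fin_suppB; [apply: fin_suppB; apply: pickfin; exact: fin_supp_delta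
  |exact: fin_supp_rdiff].
pose c l := pick l j b' - pick l i b - ldiff x (a l).
have cfin l : fin_supp (c l).
  by apply: fin_suppB; [apply: fin_suppB; exact: pickfin|exact: fin_supp_ldiff].
have omE l : ldiff x (om l) = rdiff (s l) (c l).
  rewrite /om /c 2!ldiffB 2!rdiffB ldiff_rdiff; congr (_ - _ - _); rewrite /pick.
    by case: eqP => [->|_]; rewrite ?b'E// !raddf0.
  by case: eqP => [->|_]; rewrite ?bE// !raddf0.
have sum_om : \sum_l om l = 0.
  have pick_sum l' f : \sum_l pick l l' f = f.
    by rewrite (bigD1 l')//= /pick eqxx big1 ?addr0// => l /negbTE ->.
  by rewrite 2!sumrB !pick_sum -aE subrr.
have [T Tfin TE] : exists2 T, fin_supp T & forall l, rdiff (s l) (c l) = bd l T.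
  apply: rdiff_exact => //.
  by under eq_bigr do rewrite -omE; rewrite -raddf_sum sum_om raddf0.
(* The norm of T is sent to the norm of (x - 1) [om], which is 0, so T = (x - 1) U. Subtracting the
   image of U then makes component j of [om] invariant, hence a norm. *)
have [U Ufin UE] : exists2 U, fin_supp U & T = ldiff x U.
  apply: (lnorm_eq0 n_gt0 xn1 x_ord) => //.
  apply: bd_inj; first exact: fin_supp_lnorm.
  by move=> l; rewrite -lnorm_bd -TE -omE lnorm_ldiff.
have [y yfin yE] : exists2 y, fin_supp y & om j - bd j U = lnorm x n y.
  apply: (ldiff_eq0 n_gt0 xn1 x_ord).
    by apply: fin_suppB => //; apply/fin_supp_rdiff/fin_supp_rtrans.
  by rewrite raddfB /= omE TE ldiff_bd -UE subrr.
(* The indicator of the coset h<s_j>, which x fixes. On component j, the element h contributes 1,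
   the element g contributes 0 by distinctness, and right multiples of s_j - 1 contribute 0; so 1
   would be a multiple of n. *)
pose psi k : int := if `[< cyc (s j) (h^-1 * k)%g >] then 1 else 0.
have psiR k : psi (k * s j)%g = psi k.
  congr (if _ then _ else _); apply/asbool_equiv_eq; split=> hk.
    rewrite -(mulgK (s j) (_ * k)%g) -(mulgA _ k).
    by apply: cycM => //; apply/cycV/cyc_id.
  by rewrite mulgA; apply: cycM => //; exact: cyc_id.
have psiL k : psi (x * k)%g = psi k.
  have E : (h^-1 * (x * k) = (h^-1 * x * h) * (h^-1 * k))%g.
    by rewrite -!mulgA mulVKg.
  rewrite /psi E; congr (if _ then _ else _); apply/asbool_equiv_eq; split=> hk.
    by rewrite -(mulKg (h^-1 * x * h)%g (_ * k)%g); apply: cycM => //; exact: cycV.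
  exact: cycM.
have := congr1 (wsum psi) yE.
have dfin k l f : fin_supp (pick k l (delta f)) by exact/pickfin/fin_supp_delta.
have rfin f : fin_supp f -> fin_supp (rtrans (P j) f) by exact: fin_supp_rtrans.
have wd f : fin_supp f -> wsum psi (rdiff (s j) f) = 0 by exact: wsum_rdiff.
have -> : wsum psi (om j - bd j U) = 1.
  rewrite (wsumB _ (omfin j) (fin_supp_rdiff _ (rfin _ Ufin))) wd; last exact: rfin.
  rewrite (wsumB _ (fin_suppB (dfin _ _ _) (dfin _ _ _)) (fin_supp_rdiff _ (afin j))).
  rewrite wd// wsumB// /pick eqxx wsum_delta.
  have -> : psi h = 1 by rewrite /psi mulVg asboolT//; exact: cyc1.
  have -> : wsum psi (if j == i then delta g else 0) = 0.
    case: eqP => [ji|_]; last exact: wsum0.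
    by rewrite wsum_delta /psi asboolF// => hjg; apply: distinct.
  by rewrite !subr0.
by rewrite wsum_lnorm// => /int_mul_neq1; exact.
Qed.

(** A power y of x has prime order and fixes exactly one coset; x commutes with y, so it fixes this
    coset too. *)
Theorem torsion_conj_gen x : finite_order x -> x <> 1%g ->
  exists i g, cyc (s i) (g^-1 * x * g)%g.
Proof.
move=> [n0 n0_gt0 xn0] x_neq1.
have ex : exists n, (0 < n)%N && (x ^+ n == 1)%g by exists n0; rewrite n0_gt0 xn0 eqxx.
have [n /andP[n_gt0 /eqP xn1] n_min] := ex_minnP ex.
have n_gt1 : (1 < n)%N.
  rewrite ltn_neqAle n_gt0 andbT; apply/eqP => n1.
  by apply: x_neq1; rewrite -(expg1 x) n1.
have x_ord j : (0 < j < n)%N -> (x ^+ j)%g <> 1%g.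
  move=> /andP[j_gt0 jn] xj1; have := n_min j.
  by rewrite j_gt0 xj1 eqxx leqNgt jn => /(_ isT).
pose q := pdiv n; have q_pr : prime q by exact: pdiv_prime.
have qn : (q %| n)%N by exact: pdiv_dvd.
pose r := (n %/ q)%N; have rq : (r * q)%N = n by exact: divnK.
pose y := (x ^+ r)%g.
have q_gt1 := prime_gt1 q_pr.
have y_ord k : (0 < k < q)%N -> (y ^+ k)%g <> 1%g.
  by move=> kq; rewrite -expgnA; apply: x_ord; nia.
have yq1 : (y ^+ q = 1)%g by rewrite -expgnA rq.
have y_neq1 : y <> 1%g by move=> y1; apply: (y_ord 1%N); rewrite ?expg1.
have [i [g yg]] := prime_order_fixes_coset q_pr yq1 y_neq1.
exists i, g; rewrite -mulgA.
have [|_ //] := @fixed_coset_unique y q i i (x * g)%g g q_gt1 yq1 y_ord _ yg.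
have xy : (y * x = x * y)%g by rewrite -expgSr expgS.
by rewrite invgM -!mulgA (mulgA y) xy -!mulgA mulKg mulgA.
Qed.

End Torsion.

(** * Fox calculus *)

Section PresentedWords.
Variables (I : choiceType) (R : word I -> word I -> Prop).
Local Open Scope group_scope.
Notation cls := (presented_class R).

Lemma class_cat u v : cls (u ++ v) = cls u * cls v.
Proof. by rewrite -presented_mulE. Qed.

Lemma class_nil : cls [::] = 1. Proof. by []. Qed.

Lemma class_inv u : cls (word_inv u) = (cls u)^-1.
Proof.
apply/(mulgI (cls u)); rewrite mulgV -class_cat.
by apply/presented_classP/word_mulV.
Qed.

Lemma class_gen i : cls [:: (i, false)] = presented_gen R i. Proof. by []. Qed.

Lemma class_genV i : cls [:: (i, true)] = (presented_gen R i)^-1.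
Proof. by rewrite -class_gen -class_inv. Qed.

Lemma class_nseq i k : cls (nseq k (i, false)) = presented_gen R i ^+ k.
Proof. by elim: k => // k IHk; rewrite expgS -IHk -class_cat. Qed.

Lemma class_rel u v : R u v -> cls u = cls v.
Proof. by move=> Ruv; apply/presented_classP/word_eq_rel. Qed.

Lemma presented_ind (A : set (presented R)) :
  A 1 -> (forall x y, A x -> A y -> A (x * y)) -> (forall x, A x -> A x^-1) ->
  (forall i, A (presented_gen R i)) -> forall x, A x.
Proof.
move=> A1 AM AV Agen x; rewrite -(presented_class_repr x).
elim: (repr x) => [//|[i b] u IHu]; rewrite -cat1s class_cat.
by apply: AM => //; case: b; rewrite ?class_genV; [apply: AV|]; apply: Agen.
Qed.

End PresentedWords.

Section Fox.
Variables (I : choiceType) (R : word I -> word I -> Prop).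
Local Notation G := (presented R).
Local Notation cls := (presented_class R).
Local Open Scope ring_scope.
Implicit Types (u v : word I) (i : I).

(** The Fox derivative of u with respect to the generator i, taken in Z[G]: the edges of type i,
    with signs, along the path spelled by u in the Cayley graph. *)
Fixpoint fox u i : G -> int :=
  if u is (j, b) :: u' then
    (if j == i then if b then - delta (cls [:: (j, true)]) else delta 1%g else 0)
    + ltrans (cls [:: (j, b)]) (fox u' i)
  else 0.

Lemma fox_cons j b u i : fox ((j, b) :: u) i =
  (if j == i then if b then - delta (cls [:: (j, true)]) else delta 1%g else 0)
  + ltrans (cls [:: (j, b)]) (fox u i).
Proof. by []. Qed.

Lemma fox_cat u v i : fox (u ++ v) i = fox u i + ltrans (cls u) (fox v i).
Proof.
elim: u => [|[j b] u IHu] /=; first by rewrite ltrans1 add0r.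
by rewrite IHu raddfD addrA -[_ :: u]cat1s class_cat ltransM.
Qed.

Lemma fin_supp_fox u i : fin_supp (fox u i).
Proof.
elim: u => [|[j b] u IHu] /=; first exact: fin_supp0.
apply: fin_suppD; last exact: fin_supp_ltrans.
case: eqP => _; last exact: fin_supp0.
by case: b; [apply: fin_suppN|]; exact: fin_supp_delta.
Qed.

(* The defining relations only enter through a left submodule [S] of the free
   module on the edges containing their Fox derivatives. *)
Lemma fox_word_eq (R' : word I -> word I -> Prop) (S : (I -> G -> int) -> Prop) :
  (forall c c', S c -> S c' -> S (c - c')) ->
  (forall x c, S c -> S (fun i => ltrans x (c i))) -> S 0 ->
  (forall u v, R' u v -> cls u = cls v /\ S (fox u - fox v)) ->
  forall u v, word_eq R' u v -> cls u = cls v /\ S (fox u - fox v).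
Proof.
move=> SB SL S0 SR u v; elim=> {u v}.
- by move=> u; split=> //; rewrite subrr.
- move=> u v _ [uv Suv]; split=> //.
  by rewrite -opprB -sub0r; apply: SB.
- move=> u v w _ [uv Suv] _ [vw Svw]; split; first by rewrite uv.
  rewrite (_ : _ - _ = (fox u - fox v) - (0 - (fox v - fox w))).
    by apply: (SB) => //; apply: SB.
  by rewrite sub0r opprK addrA subrK.
- move=> u u' v v' _ [uu' Su] _ [vv' Sv]; split; first by rewrite !class_cat uu' vv'.
  rewrite (_ : _ - _ = (fox u - fox u') -
     (0 - (fun i => ltrans (cls u) ((fox v - fox v') i)))).
    by apply: (SB) => //; apply: SB => //; apply: SL.
  rewrite sub0r opprK; apply/funext => i.
  rewrite -[LHS]/(fox (u ++ v) i - fox (u' ++ v') i) !fox_cat -uu'.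
  rewrite -[RHS]/(fox u i - fox u' i + ltrans (cls u) (fox v i - fox v' i)).
  by rewrite raddfB opprD addrACA.
- move=> i b; split; first exact/presented_classP/word_eq_cancel.
  rewrite (_ : _ - _ = 0)// subr0; apply/funext => j /=.
  rewrite raddf0 addr0; case: eqP => [_|]; last by rewrite raddf0 addr0.
  case: b => /=; last first.
    by rewrite raddfN /= ltrans_delta class_gen class_genV mulgV subrr.
  by rewrite ltrans_delta mulg1 addNr.
- exact: SR.
Qed.

End Fox.

(** * The group D and the Fox derivatives of its relators *)

Section CentralQuotient.
Variables (p : nat) (K : 'I_p -> option nat).
Local Open Scope ring_scope.

Inductive D_rel : word 'I_p -> word 'I_p -> Prop :=
| D_rel_prod : D_rel (gen_word p) [::]
| D_rel_order i k : K i = Some k -> D_rel (nseq k (i, false)) [::].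

Definition Dgroup : groupType := presented D_rel.

Notation cls := (presented_class D_rel).
Notation fox := (@fox _ D_rel).
Implicit Types (T U : Dgroup -> int) (i j : 'I_p).

Definition D_gen i : Dgroup := presented_gen D_rel i.
Definition D_prefix i : Dgroup := cls (take i (gen_word p)).
Notation s := D_gen.
Notation P := D_prefix.

Lemma size_gen_word : size (gen_word p) = p.
Proof. by rewrite size_map size_enum_ord. Qed.

Lemma take_gen_word i :
  take i.+1 (gen_word p) = take i (gen_word p) ++ [:: (i, false)].
Proof.
rewrite (take_nth (i, false)) ?size_gen_word// -cats1; congr (_ ++ [:: _]).
by rewrite (nth_map i) ?size_enum_ord// nth_ord_enum.
Qed.

Lemma D_prefixS i : (P i * s i)%g = cls (take i.+1 (gen_word p)).
Proof. by rewrite take_gen_word class_cat. Qed.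

Lemma class_gen_word : cls (gen_word p) = 1%g.
Proof. exact/class_rel/D_rel_prod. Qed.

Lemma D_gen_order i k : K i = Some k -> (s i ^+ k = 1)%g.
Proof. by move=> Ki; rewrite -class_nseq; apply/class_rel/(D_rel_order Ki). Qed.

(** The sum telescopes from the empty prefix to s_1 ... s_p = 1. *)
Lemma sum_bd_D T : \sum_i bd s P i T = 0.
Proof.
pose F m := rtrans (cls (take m (gen_word p))) T.
have -> : \sum_i bd s P i T = \sum_(i < p) (F i.+1 - F i).
  by apply: eq_bigr => i _; rewrite /F -D_prefixS rtransM.
rewrite -(big_mkord xpredT (fun m => F m.+1 - F m)) telescope_sumr// /F.
by rewrite take_oversize ?size_gen_word// class_gen_word take0 subrr.
Qed.

(** The fundamental formula of Fox calculus, by induction on a word representing g. *)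
Lemma delta_gen_D (g : Dgroup) :
  exists2 a : 'I_p -> Dgroup -> int, (forall i, fin_supp (a i)) &
  delta g - delta 1%g = \sum_i rdiff (s i) (a i).
Proof.
exists (fox (repr g)); first by move=> i; exact: fin_supp_fox.
rewrite -{1}(presented_class_repr g); elim: (repr g) => [|[j b] u IHu].
  by rewrite class_nil subrr big1// => i _; rewrite /= raddf0.
have -> : delta (cls ((j, b) :: u)) = ltrans (cls [:: (j, b)]) (delta (cls u)).
  by rewrite ltrans_delta -class_cat.
pose e i := if j == i then if b then - delta (cls [:: (j, true)]) else delta 1%g else 0.
have step i : rdiff (s i) (fox ((j, b) :: u) i) =
    rdiff (s i) (e i) + ltrans (cls [:: (j, b)]) (rdiff (s i) (fox u i)).
  by rewrite fox_cons rdiffD ltrans_rdiff.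
rewrite (eq_bigr _ (fun i _ => step i)) big_split -raddf_sum -IHu raddfB /=.
rewrite (ltrans_delta _ 1%g) mulg1 [RHS]addrC -[RHS]addrA; congr (_ + _).
have -> : \sum_i rdiff (s i) (e i) = rdiff (s j) (e j).
  rewrite (bigD1 j)//= big1 ?addr0// => i ij.
  by rewrite /e eq_sym (negbTE ij) raddf0.
rewrite /e eqxx -[LHS](addKr (delta (cls [:: (j, b)]))); congr (_ + _).
rewrite /rdiff; case: (b); last by rewrite rtrans_delta mul1g.
by rewrite raddfN /= rtrans_delta class_genV mulVg opprK addrC.
Qed.

(** By induction T is right invariant under all prefixes, hence under every s_i, so it is constant;
    finite support in an infinite group makes it 0. *)
Lemma bd_inj_D : infinite_set [set: Dgroup]%classic ->
  forall T, fin_supp T -> (forall i, bd s P i T = 0) -> T = 0.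
Proof.
move=> Dinf T [r Tr] bdT.
have TP m : (m <= p)%N -> rtrans (cls (take m (gen_word p))) T = T.
  elim: m => [|m IHm] mp; first by rewrite take0 rtrans1.
  rewrite -(D_prefixS (Ordinal mp)) rtransM; apply/eqP.
  by rewrite -subr_eq0 -{2}IHm 1?ltnW//; apply/eqP/(bdT (Ordinal mp)).
have Ts i : rtrans (s i) T = T.
  have := TP i.+1 (ltn_ord i).
  by rewrite -D_prefixS rtransM [rtrans (P i) T]TP// ltnW.
have Tg (g : Dgroup) : rtrans g T = T.
  apply: (@presented_ind _ D_rel (fun g => rtrans g T = T)) => //.
  - exact: rtrans1.
  - by move=> x y xT yT; rewrite rtransM xT yT.
  - by move=> x xT; rewrite -{1}xT -rtransM mulgV rtrans1.
have Tconst g : T g = T 1%g by rewrite -{1}(Tg g) /rtrans mulgV.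
have [g gr] : exists g : Dgroup, g \notin r.
  apply: contrapT => rall; apply: Dinf.
  apply: (@sub_finite_set _ _ [set` r]); last exact: finite_seq.
  by move=> g _ /=; apply/negPn/negP => gr; apply: rall; exists g.
by apply/funext => h; rewrite Tconst -(Tconst g) Tr.
Qed.

(** Right multiples, by b, of the Fox derivative 1 + s_i + ... + s_i^(k-1) of the relator s_i^k; an
    infinite exponent gives no relator, hence 0. *)
Definition order_norm i (b : Dgroup -> int) : Dgroup -> int :=
  if K i is Some k then \sum_(j < k) rtrans (s i ^+ j)%g b else 0.

Lemma order_norm_is_zmod_morphism i : zmod_morphism (order_norm i).
Proof.
move=> b c; rewrite /order_norm; case: (K i) => [k|]; last by rewrite subr0.
by rewrite -sumrB; apply: eq_bigr => j _; rewrite raddfB.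
Qed.
HB.instance Definition _ i := GRing.isZmodMorphism.Build (Dgroup -> int)
  (Dgroup -> int) (order_norm i) (order_norm_is_zmod_morphism i).

Lemma ltrans_order_norm x i b :
  ltrans x (order_norm i b) = order_norm i (ltrans x b).
Proof.
rewrite /order_norm; case: (K i) => [k|]; last by rewrite raddf0.
by rewrite raddf_sum; apply: eq_bigr => j _; rewrite /= ltrans_rtrans.
Qed.

Lemma rdiff_order_norm i b : rdiff (s i) (order_norm i b) = 0.
Proof.
rewrite /rdiff /order_norm; case Ki : (K i) => [k|]; last by rewrite raddf0 subrr.
rewrite raddf_sum -sumrB /=; under eq_bigr do rewrite -rtransM -expgSr.
rewrite -(big_mkord xpredT (fun m => rtrans (s i ^+ m.+1)%g b - rtrans (s i ^+ m)%g b)).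
by rewrite (telescope_sumr (fun m => rtrans (s i ^+ m)%g b))// (D_gen_order Ki) subrr.
Qed.

(* The submodule of the free module on the edges spanned by the boundaries of
   the relators; [Q] restricts the multiplicity of the relator s_1 ... s_p. *)
Definition relators (Q : set (Dgroup -> int)) (c : 'I_p -> Dgroup -> int) : Prop :=
  exists b T, [/\ forall i, fin_supp (b i), fin_supp T, Q T
    & forall i, c i = order_norm i (b i) + rtrans (P i) T].

Section Relators.
Variable Q : set (Dgroup -> int).
Hypotheses (QB : forall T U, fin_supp T -> fin_supp U -> Q T -> Q U -> Q (T - U))
  (QL : forall x T, Q T -> Q (ltrans x T)) (Q0 : Q 0).

Lemma relators0 : relators Q 0.
Proof.
exists (fun=> 0), 0; split=> //; do 1?[move=> i]; try exact: fin_supp0.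
by rewrite !raddf0 addr0.
Qed.

Lemma relatorsB c c' : relators Q c -> relators Q c' -> relators Q (c - c').
Proof.
move=> [b [T [bfin Tfin QT cE]]] [b' [T' [b'fin T'fin QT' c'E]]].
exists (fun i => b i - b' i), (T - T'); split; [|exact: fin_suppB|exact: QB|].
  by move=> i; exact: fin_suppB.
by move=> i; rewrite -[LHS]/(c i - c' i) cE c'E !raddfB opprD addrACA.
Qed.

Lemma relatorsL x c : relators Q c -> relators Q (fun i => ltrans x (c i)).
Proof.
move=> [b [T [bfin Tfin QT cE]]].
exists (fun i => ltrans x (b i)), (ltrans x T); split; [|exact: fin_supp_ltrans|exact: QL|].
  by move=> i; exact: fin_supp_ltrans.
by move=> i; rewrite cE raddfD /= ltrans_order_norm ltrans_rtrans.
Qed.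

Lemma relatorsMz c (n : int) : relators Q c -> relators Q (c *~ n).
Proof.
have relD c1 c2 : relators Q c1 -> relators Q c2 -> relators Q (c1 + c2).
  move=> rc1 rc2; rewrite -[c2]opprK -[- c2]sub0r.
  by apply: relatorsB => //; apply: relatorsB => //; exact: relators0.
move=> rc; have rn (k : nat) : relators Q (c *+ k).
  by elim: k => [|k IHk]; [exact: relators0|rewrite mulrS; apply: relD].
case: n => k; first exact: rn.
by rewrite NegzE mulrNz -[- _]sub0r; apply: relatorsB; [exact: relators0|exact: rn].
Qed.

Lemma fox_nseq i k j : fox (nseq k (i, false)) j =
  if i == j then \sum_(m < k) delta (s i ^+ m)%g else 0.
Proof.
elim: k => [|k IHk]; first by rewrite big_ord0 if_same.
rewrite -addn1 nseqD fox_cat IHk /= class_nseq raddf0 addr0.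
case: eqP => [_|_]; last by rewrite raddf0 addr0.
by rewrite addn1 big_ord_recr /= ltrans_delta mulg1.
Qed.

Lemma order_norm_delta1 i k : K i = Some k ->
  order_norm i (delta 1%g) = \sum_(m < k) delta (s i ^+ m)%g.
Proof.
rewrite /order_norm => ->; apply: eq_bigr => m _.
by rewrite rtrans_delta mul1g.
Qed.

Lemma relators_order i k : K i = Some k ->
  relators Q (fox (nseq k (i, false)) - fox [::]).
Proof.
move=> Ki; exists (fun j => if i == j then delta 1%g else 0), 0.
split=> //; last 1 first.
- move=> j; rewrite -[LHS]/(fox (nseq k (i, false)) j - 0) fox_nseq subr0 raddf0 addr0.
  by case: eqP => [<-|_]; rewrite ?raddf0// (order_norm_delta1 Ki).
- move=> j; case: eqP => _; [exact: fin_supp_delta|exact: fin_supp0].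
- exact: fin_supp0.
Qed.

End Relators.

(** Each letter occurs once, so only the prefix in front of it survives. *)
Lemma fox_gen_word i : fox (gen_word p) i = delta (P i).
Proof.
have foxl (l : seq 'I_p) : uniq l ->
    fox [seq (j, false) | j <- l] i =
    if i \in l then delta (cls (take (index i l) [seq (j, false) | j <- l])) else 0.
  elim: l => [|j l IHl] //; rewrite cons_uniq => /andP[jl ul].
  rewrite [[seq _ | _ <- _]]/= fox_cons IHl// inE /= [i == j]eq_sym.
  case: eqP => [<-|_] /=; first by rewrite (negbTE jl) raddf0 addr0.
  rewrite add0r; case: ifP => _; last by rewrite raddf0.
  by rewrite ltrans_delta -class_cat.
by rewrite foxl ?enum_uniq// mem_enum index_enum_ord.
Qed.

Lemma class_rot_gen_word a : cls (rot a (gen_word p)) = 1%g.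
Proof.
rewrite /rot class_cat; have := class_gen_word.
rewrite -{1}(cat_take_drop a (gen_word p)) class_cat => td1.
by apply/(mulgI (cls (take a (gen_word p)))); rewrite mulgA td1 mul1g mulg1.
Qed.

(** If u v = s_1 ... s_p, then v u = 1 in D, so v times the derivative of u v is the derivative of v
    u. *)
Lemma fox_rot_gen_word a i : fox (rot a (gen_word p)) i =
  rtrans (P i) (delta (cls (drop a (gen_word p)))).
Proof.
have := class_rot_gen_word a; rewrite /rot class_cat => dt1.
rewrite fox_cat rtrans_delta -ltrans_delta -fox_gen_word.
have -> : fox (gen_word p) i = fox (take a (gen_word p)) i +
    ltrans (cls (take a (gen_word p))) (fox (drop a (gen_word p)) i).
  by rewrite -fox_cat cat_take_drop.
by rewrite raddfD /= -ltransM dt1 ltrans1 addrC.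
Qed.

End CentralQuotient.

Lemma mulrz_fctE (T : Type) (M : zmodType) (f : T -> M) (n : int) (t : T) :
  ((f *~ n) t = f t *~ n)%R.
Proof.
have natE (k : nat) : ((f *+ k) t = f t *+ k)%R.
  by elim: k => // k IHk; rewrite !mulrS -IHk.
by case: n => k; [exact: natE|rewrite NegzE !mulrNz -[LHS]/(- ((f *+ k.+1) t))%R natE].
Qed.

(** * Exactness in the middle, and torsion in D *)

Section Exactness.
Variables (p : nat) (K : 'I_p -> option nat).
Local Open Scope ring_scope.
Local Notation D := (Dgroup K).
Local Notation cls := (presented_class (D_rel K)).
Local Notation fox := (@fox _ (D_rel K)).
Local Notation s := (D_gen K).
Local Notation P := (D_prefix K).

Lemma relators_fox_D u v : word_eq (D_rel K) u v ->
  relators setT (fox u - fox v).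
Proof.
move=> uv; apply: (proj2 (fox_word_eq _ _ _ _ uv)) => {u v uv}.
- by move=> c c'; apply: relatorsB.
- by move=> x c; apply: relatorsL.
- exact: relators0.
move=> u v Ruv; split; first exact: class_rel.
case: Ruv => [|i k Ki]; last exact: relators_order.
exists (fun=> 0), (delta 1%g); split=> //; first by move=> i; exact: fin_supp0.
  exact: fin_supp_delta.
move=> i; rewrite -[LHS]/(fox (gen_word p) i - 0) subr0 fox_gen_word.
by rewrite raddf0 add0r rtrans_delta mul1g.
Qed.

Lemma sum_relators Q (I : Type) (r : seq I) (F : I -> 'I_p -> D -> int) :
  (forall T U, fin_supp T -> fin_supp U -> Q T -> Q U -> Q (T - U)) -> Q 0 ->
  (forall i, relators Q (F i)) -> relators Q (\sum_(i <- r) F i).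
Proof.
move=> QB Q0 FQ; elim/big_ind: _ => // [|c c' Qc Qc']; first exact: relators0.
rewrite -[c']opprK -[- c']sub0r; apply: relatorsB => //.
by apply: relatorsB => //; exact: relators0.
Qed.

(* Along a word representing g s_i, the Fox derivative is the one along a word
   representing g plus the edge (g, g s_i), modulo relators. Hence the linear
   extension of g |-> fox (repr g) inverts the boundary map modulo relators. *)
Lemma cycle_relators (a : 'I_p -> D -> int) : (forall i, fin_supp (a i)) ->
  \sum_i rdiff (s i) (a i) = 0 -> relators setT a.
Proof.
move=> afin a0.
pose edge (i : 'I_p) (g : D) : 'I_p -> D -> int := fun j => if i == j then delta g else 0.
pose X i (g : D) := fox (repr (g * s i)%g) - fox (repr g) - edge i g.
have XR i g : relators setT (X i g).
  have : word_eq (D_rel K) (repr (g * s i)%g) (repr g ++ [:: (i, false)]).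
    by apply/presented_classP; rewrite class_cat !presented_class_repr.
  move=> /relators_fox_D; congr relators; rewrite /X -addrA -opprD.
  congr (_ - _); apply/funext => j; rewrite fox_cat presented_class_repr /=.
  rewrite raddf0 addr0 /edge -[RHS]/(fox (repr g) j + _); congr (_ + _).
  by case: eqP => _; rewrite ?raddf0// ltrans_delta mulg1.
have rex i : exists ri : seq D, uniq ri /\ (forall g, g \notin ri -> a i g = 0).
  have [ri riP] := afin i; exists (undup ri); split; first exact: undup_uniq.
  by move=> g; rewrite mem_undup => /riP.
have [r rP] := choice rex.
pose Y : 'I_p -> D -> int := \sum_i \sum_(g <- r i) X i g *~ a i g.
have YR : relators setT Y.
  by do 2![apply: sum_relators => // ?]; apply: relatorsMz.
(* In [Y] the Fox terms add up to a pairing with the boundary of [a], which is 0, and the subtracted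
   edge terms add up to [a]. *)
suff <- : 0 - Y = a by apply: relatorsB => //; exact: relators0.
apply/funext => j; apply/funext => h; rewrite -[LHS]/(0 - Y j h) sub0r.
pose w (g : D) : int := fox (repr g) j h.
have wE i : (\sum_(g <- r i) X i g *~ a i g) j h =
    wsum w (rdiff (s i) (a i)) - (if i == j then a i h else 0).
  have [ri_uniq riP] := rP i.
  rewrite !fct_sumE wsumB//; last exact: fin_supp_rtrans.
  rewrite wsum_rtrans !(wsumE _ ri_uniq riP) -sumrB.
  have -> : (if i == j then a i h else 0) = \sum_(g <- r i) edge i g j h * a i g.
    rewrite /edge; case: eqP => [_|_]; last by rewrite big1// => g _; rewrite mul0r.
    by rewrite -(wsumE _ ri_uniq riP) wsum_deltal.
  rewrite -sumrB; apply: eq_bigr => g _.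
  by rewrite !mulrz_fctE -[X in X *~ _]/(w (g * s i)%g - w g - edge i g j h) -mulrzr intz !mulrBl.
rewrite /Y fct_sumE fct_sumE (eq_bigr _ (fun i _ => wE i)) sumrB -wsum_sum; last first.
  by move=> i; exact: fin_supp_rdiff.
rewrite a0 wsum0 sub0r opprK (bigD1 j)//= eqxx big1 ?addr0// => i ij.
by rewrite (negbTE ij).
Qed.

(** Multiplication by s_i - 1 kills the part of the cycle coming from s_i^k and leaves the part
    coming from s_1 ... s_p. *)
Lemma rdiff_exact_D (a : 'I_p -> D -> int) : (forall i, fin_supp (a i)) ->
  \sum_i rdiff (s i) (a i) = 0 ->
  exists2 T, fin_supp T & forall i, rdiff (s i) (a i) = bd s P i T.
Proof.
move=> afin /(cycle_relators afin)[b [T [_ Tfin _ aE]]]; exists T => // i.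
by rewrite aE rdiffD rdiff_order_norm add0r.
Qed.

Lemma torsion_D (x : D) : infinite_set [set: D]%classic -> finite_order x ->
  x <> 1%g -> exists i g, cyc (s i) (g^-1 * x * g)%g.
Proof.
move=> Dinf; apply: torsion_conj_gen.
- exact: rdiff_exact_D.
- exact: bd_inj_D.
- exact: sum_bd_D.
- exact: delta_gen_D.
Qed.

End Exactness.

(** * The central extension J(K) of D *)

Section CentralExtension.
Variables (p : nat) (K : 'I_p -> option nat).
Local Notation J := (Jgroup K).
Local Notation D := (Dgroup K).
Local Notation clsJ := (presented_class (J_rel K)).
Local Notation clsD := (presented_class (D_rel K)).

Definition J_center : J := clsJ (gen_word p).
Local Notation z := J_center.

Section RelationModule.
Local Open Scope ring_scope.
Local Notation fox := (@fox _ (D_rel K)).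
Local Notation P := (D_prefix K).

Definition augmentation_ideal : set (D -> int) :=
  [set T | wsum (fun=> 1) T = 0]%classic.

(** The derivatives of two rotations of s_1 ... s_p differ by a multiple whose coefficient is a
    difference of two group elements, of augmentation 0. This is what later detects the powers of
    z. *)
Lemma relators_fox_J u v : word_eq (J_rel K) u v ->
  clsD u = clsD v /\ relators augmentation_ideal (fox u - fox v).
Proof.
have QB (T U : D -> int) : fin_supp T -> fin_supp U -> augmentation_ideal T ->
    augmentation_ideal U -> augmentation_ideal (T - U).
  by rewrite /augmentation_ideal /= => Tf Uf T0 U0; rewrite wsumB// T0 U0 subrr.
have Q0 : augmentation_ideal 0 by exact: wsum0.
apply: fox_word_eq => {u v}; [exact: relatorsB| |exact: relators0|].
  apply: relatorsL => x T; rewrite /augmentation_ideal /= => T0.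
  by rewrite wsum_ltrans.
move=> u v; case=> [a b|i k Ki]; last first.
  by split; [exact/class_rel/D_rel_order|exact: relators_order].
split; first by rewrite !class_rot_gen_word.
exists (fun=> 0), (delta (clsD (drop a (gen_word p))) - delta (clsD (drop b (gen_word p)))).
split=> [i|||i].
- exact: fin_supp0.
- by apply: fin_suppB; exact: fin_supp_delta.
- rewrite /augmentation_ideal /= wsumB; [|exact: fin_supp_delta..].
  by rewrite !wsum_delta subrr.
- rewrite -[LHS]/(fox (rot a (gen_word p)) i - fox (rot b (gen_word p)) i).
  by rewrite !fox_rot_gen_word raddf0 add0r raddfB.
Qed.

End RelationModule.

Local Open Scope group_scope.

Definition J_proj (x : J) : D := clsD (repr x).

Lemma J_proj_class u : J_proj (clsJ u) = clsD u.
Proof.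
have /relators_fox_J[] // := repr_presented_class (J_rel K) u.
Qed.

Lemma J_projM x y : J_proj (x * y) = J_proj x * J_proj y.
Proof.
rewrite -(presented_class_repr x) -(presented_class_repr y) -class_cat.
by rewrite !J_proj_class class_cat.
Qed.

Lemma J_proj1 : J_proj 1 = 1. Proof. exact: J_proj_class. Qed.

Lemma J_projV x : J_proj x^-1 = (J_proj x)^-1.
Proof. by apply/(mulgI (J_proj x)); rewrite -J_projM !mulgV J_proj1. Qed.

Lemma J_projX x n : J_proj (x ^+ n) = J_proj x ^+ n.
Proof. by elim: n => [|n IHn]; rewrite ?J_proj1// !expgS J_projM IHn. Qed.

Lemma J_proj_gen i : J_proj (J_gen K i) = D_gen K i.
Proof. exact: J_proj_class. Qed.

Lemma J_proj_expgz x n : J_proj (expgz x n) = expgz (J_proj x) n.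
Proof. by case: n => n /=; rewrite ?J_projV J_projX. Qed.

(** Two consecutive rotations give z = s_i w2 w1 = w2 w1 s_i, so s_i z and z s_i both equal s_i w2
    w1 s_i. *)
Lemma commute_J_center x : commute x z.
Proof.
apply: (@presented_ind _ (J_rel K) (fun x => commute x z)) => {x}.
- exact/commute_sym/commute1.
- by move=> x y xz yz; apply/commute_sym/commuteM; exact: commute_sym.
- by move=> x xz; apply/commute_sym/commuteV/commute_sym.
move=> i; pose w1 := take i (gen_word p); pose w2 := drop i.+1 (gen_word p).
have wE : gen_word p = w1 ++ [:: (i, false)] ++ w2.
  by rewrite catA -take_gen_word cat_take_drop.
have rotE w w' : gen_word p = w ++ w' -> z = clsJ (w' ++ w).
  move=> E; have := class_rel (J_rel_rot K 0 (size w)).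
  by rewrite rot0 {2}E rot_size_cat.
have z1 := rotE _ _ wE; have := wE; rewrite catA => /rotE z2.
rewrite /commute {1}z2 z1 /J_gen -class_gen -!class_cat.
by rewrite -!catA.
Qed.

(** The kernel of J(K) -> D is <z>: each use of s_1 ... s_p = 1 costs a central factor z. *)
Lemma D_eq_J_center u v : word_eq (D_rel K) u v ->
  exists n, clsJ u = clsJ v * expgz z n.
Proof.
elim=> {u v}.
- by move=> u; exists 0%R; rewrite mulg1.
- move=> u v _ [n ->]; exists (- n)%R.
  by rewrite -mulgA -expgzD subrr mulg1.
- move=> u v w _ [n ->] _ [m ->]; exists (m + n)%R.
  by rewrite -mulgA -expgzD.
- move=> u u' v v' _ [n uE] _ [m vE]; exists (n + m)%R.
  rewrite !class_cat uE vE expgzD -!mulgA; congr (_ * _).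
  by rewrite !mulgA (commute_expgz _ (commute_J_center (clsJ v'))).
- by move=> i b; exists 0%R; rewrite mulg1; exact/presented_classP/word_eq_cancel.
- move=> u v [|i k Ki]; first by exists 1%R; rewrite mul1g expgz1.
  by exists 0%R; rewrite mulg1; exact/class_rel/J_rel_order.
Qed.

Lemma J_proj_eq x y : J_proj x = J_proj y -> exists n, x = y * expgz z n.
Proof.
rewrite /J_proj => /presented_classP /D_eq_J_center.
by rewrite !presented_class_repr.
Qed.

Definition gen_word_pow n : word 'I_p := flatten (nseq n (gen_word p)).

Lemma class_gen_word_pow n : clsJ (gen_word_pow n) = z ^+ n.
Proof. by elim: n => // n IHn; rewrite expgS -IHn -class_cat. Qed.

Lemma classD_gen_word_pow n : clsD (gen_word_pow n) = 1.
Proof.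
by elim: n => // n IHn; rewrite /gen_word_pow /= class_cat IHn class_gen_word mul1g.
Qed.

Lemma fox_gen_word_pow n i :
  @fox _ (D_rel K) (gen_word_pow n) i = (rtrans (D_prefix K i) (delta 1%g *+ n))%R.
Proof.
elim: n => [|n IHn]; first by rewrite mulr0n raddf0.
rewrite /gen_word_pow /= fox_cat IHn class_gen_word ltrans1 fox_gen_word.
by rewrite mulrS raddfD /= rtrans_delta mul1g.
Qed.

Hypothesis Dinf : infinite_set [set: D]%classic.

Lemma gen_center_pow_nat i (a b c : nat) :
  z ^+ c * J_gen K i ^+ a = z ^+ b -> b = c.
Proof.
rewrite -!class_gen_word_pow -[J_gen K i]/(presented_gen (J_rel K) i).
rewrite -class_nseq -class_cat => /presented_classP /relators_fox_J[].
rewrite class_cat !classD_gen_word_pow mul1g class_nseq => sa1.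
move=> [B [T [Bfin Tfin T0 E]]].
(* Comparing the derivatives of z^c s_i^a and z^b gives T' P_j up to terms killed by s_j - 1, since
   s_i^a = 1 in D. Hence T' = 0, and its augmentation is b - c. *)
pose T' := (T - delta 1%g *+ c + delta 1%g *+ b)%R.
have nfin k : fin_supp (delta (1 : D) *+ k)%R.
  elim: k => [|k IHk]; first exact: fin_supp0.
  by rewrite mulrS; apply: fin_suppD => //; exact: fin_supp_delta.
have T'fin : fin_supp T' by apply: fin_suppD => //; exact: fin_suppB.
have T'0 : T' = 0%R.
  apply: bd_inj_D => // j; rewrite /bd.
  have -> : rtrans (D_prefix K j) T' =
      (@fox _ (D_rel K) (nseq a (i, false)) j - order_norm j (B j))%R.
    rewrite /T' raddfD raddfB /=.
    have E' : (rtrans (D_prefix K j) (delta 1%g *+ c) + @fox _ (D_rel K) (nseq a (i, false)) j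
        = order_norm j (B j) + rtrans (D_prefix K j) T
          + rtrans (D_prefix K j) (delta 1%g *+ b))%R.
      apply/eqP; rewrite -subr_eq -E; apply/eqP; congr (_ - _)%R.
        by rewrite fox_cat fox_gen_word_pow classD_gen_word_pow ltrans1.
      by rewrite fox_gen_word_pow.
    apply: (addIr (rtrans (D_prefix K j) (delta 1%g *+ c)%R)).
    rewrite addrAC subrK [RHS]addrAC [X in (X - _)%R]addrC E'.
    by rewrite [RHS]addrC !addrA addNr add0r.
  rewrite rdiffB rdiff_order_norm subr0 fox_nseq.
  case: eqP => [<-|_]; last by rewrite raddf0.
  rewrite /rdiff raddf_sum -sumrB /=; under eq_bigr do rewrite rtrans_delta -expgSr.
  rewrite -(big_mkord xpredT (fun m => delta (D_gen K i ^+ m.+1) - delta (D_gen K i ^+ m))%R).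
  by rewrite (telescope_sumr (fun m => delta (D_gen K i ^+ m)))// sa1 subrr.
have := congr1 (wsum (fun=> 1%R)) T'0.
rewrite wsum0 wsumD ?wsumB//; last exact: fin_suppB.
have nw k : wsum (fun=> 1%R) (delta (1 : D) *+ k)%R = Posz k.
  elim: k => [|k IHk]; first by rewrite mulr0n wsum0.
  by rewrite mulrS wsumD ?IHk ?wsum_delta//; exact: fin_supp_delta.
by rewrite T0 !nw sub0r; lia.
Qed.

Lemma gen_center_pow i m n : expgz (J_gen K i) m = expgz z n -> n = 0%R.
Proof.
have pos (a : nat) k : J_gen K i ^+ a = expgz z k -> k = 0%R.
  have [b [c ->]] := int_natB k; rewrite expgzB => E.
  suff -> : b = c by rewrite subrr.
  apply: (@gen_center_pow_nat i a).
  rewrite E mulgA -(commuteX2 b c (commute_refl z)).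
  by rewrite mulgK.
case: m => a /=; first exact: pos.
move=> E; have : J_gen K i ^+ a.+1 = expgz z (- n)%R by rewrite expgzN -E invgK.
by move=> /pos /eqP; rewrite oppr_eq0 => /eqP.
Qed.

Lemma torsion_J (i0 : 'I_p) (x : J) : finite_order x -> x <> 1 ->
  exists i y g, cyc (J_gen K i) y /\ x = y ^ g.
Proof.
move=> [N N_gt0 xN] x_neq1.
have [X1|X_neq1] := eqVneq (J_proj x) 1.
  have [n xE] : exists n, x = 1 * expgz z n by apply: J_proj_eq; rewrite X1 J_proj1.
  (* The zeroth power of s_i0 turns [gen_center_pow] into the infinite order of z. *)
  rewrite mul1g in xE; have n0 : n = 0%R.
    have : expgz (J_gen K i0) 0 = expgz z (n * N%:Z)%R by rewrite expgzM -xE xN.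
    by move=> /gen_center_pow; lia.
  by case: x_neq1; rewrite xE n0.
have [||i [g [m mE]]] := @torsion_D p K (J_proj x) Dinf; last 1 first.
- pose h := clsJ (repr g).
  have hE : J_proj h = g by rewrite J_proj_class presented_class_repr.
  have [n xE] : exists n, h^-1 * x * h = expgz (J_gen K i) m * expgz z n.
    by apply: J_proj_eq; rewrite !J_projM J_projV hE mE J_proj_expgz J_proj_gen.
  exists i, (expgz (J_gen K i) m), h^-1; split; first by exists m.
  (* The N-th power of s_i^m z^n is 1, so s_i^(mN) is a power of z. *)
  suff n0 : n = 0%R.
    by rewrite n0 mulg1 in xE; rewrite conjgE invgK -xE -!mulgA mulVKg mulgV mulg1.
  have czn : commute (expgz (J_gen K i) m) (expgz z n).
    exact/commute_expgz/commute_J_center.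
  have := congr1 (fun y => y ^+ N) xE.
  rewrite /= (expgMn _ czn) -!expgzM -mulgA -conjgE -conjXg xN conj1g.
  move=> E1; have : expgz (J_gen K i) (m * N%:Z)%R = expgz z (- (n * N%:Z))%R.
    apply/(mulIg (expgz z (n * N%:Z)%R)).
    by rewrite -E1 -expgzD addNr.
  by move=> /gen_center_pow; lia.
- by exists N => //; rewrite -J_projX xN J_proj1.
- exact/eqP.
Qed.

End CentralExtension.

(** * The transfer to the centre when D is finite *)

Section Transfer.
Variables (p : nat) (K : 'I_p -> option nat).
Local Open Scope group_scope.
Local Notation J := (Jgroup K).
Local Notation D := (Dgroup K).
Local Notation z := (J_center K).

Hypothesis Dfin : finite_set [set: D]%classic.
Hypothesis Kfin : forall i, exists2 k, 0 < k & K i = Some k.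

Lemma fin_supp_finite (f : D -> int) : fin_supp f.
Proof.
have /finite_seqP[r rE] := Dfin; exists r => g gr.
have : [set: D]%classic g by [].
by rewrite rE /= (negbTE gr).
Qed.

(* If z had infinite order, the transfer J -> <z> would be a homomorphism to
   int killing every generator, but mapping z to the order of the quotient D. *)
Lemma J_center_finite_order : finite_order z.
Proof.
apply: contrapT => z_inf.
have z_free n : expgz z n = 1 -> n = 0%R.
  have zX k : z ^+ k.+1 <> 1 by move=> zk; apply: z_inf; exists k.+1.
  case: n => [[//|k] /zX //|k] /= zk; case: (zX k).
  by rewrite -[LHS]invgK zk invg1.
have z_inj m n : expgz z m = expgz z n -> m = n.
  move=> mn; apply/eqP; rewrite -subr_eq0; apply/eqP/z_free.
  by rewrite expgzD mn -expgzD subrr.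
pose lift (g : D) : J := presented_class (J_rel K) (repr g).
have liftK g : J_proj (lift g) = g by rewrite J_proj_class presented_class_repr.
(* The section [lift] respects left multiplication up to a power of z. The exponent is a cocycle
   [c], and its sum [tau] over D is the transfer. *)
have ex (xg : J * D) : exists n, xg.1 * lift xg.2 = lift (J_proj xg.1 * xg.2) * expgz z n.
  by apply: J_proj_eq; rewrite J_projM !liftK.
have [c' c'E] := choice ex; pose c x g := c' (x, g).
have cE x g : x * lift g = lift (J_proj x * g) * expgz z (c x g) by exact: (c'E (x, g)).
have cM x y g : c (x * y) g = (c x (J_proj y * g)%g + c y g)%R.
  apply/z_inj/(mulgI (lift (J_proj (x * y) * g))).
  transitivity (x * (y * lift g)); first by rewrite -(cE (x * y) g) mulgA.
  by rewrite (cE y g) mulgA (cE x) expgzD J_projM -!mulgA.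
pose tau x := wsum (fun=> 1%R) (c x).
have tauM x y : tau (x * y) = (tau x + tau y)%R.
  rewrite /tau (_ : c (x * y) = (ltrans (J_proj y)^-1%g (c x) + c y)%R).
    by rewrite wsumD ?wsum_ltrans//; exact: fin_supp_finite.
  by apply/funext => g; rewrite cM -[RHS]/(_ + _)%R /ltrans invgK.
have tau1 : tau 1 = 0%R by apply: (@addrI _ (tau 1)); rewrite -tauM mulg1 addr0.
have tau0 x : tau x = 0%R.
  apply: (@presented_ind _ (J_rel K) (fun x => tau x = 0%R)) => //.
  - by move=> {}x y x0 y0; rewrite tauM x0 y0.
  - move=> {}x x0; apply: (@addrI _ (tau x)); by rewrite -tauM mulgV tau1 x0.
  move=> i; have [k k_gt0 Ki] := Kfin i.
  have : tau (J_gen K i ^+ k) = 0%R.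
    rewrite -[RHS]tau1; congr tau; rewrite -[LHS]class_nseq.
    exact/class_rel/J_rel_order.
  have -> : tau (J_gen K i ^+ k) = (k%:Z * tau (J_gen K i))%R.
    elim: k {k_gt0 Ki} => [|k IHk]; first by rewrite mul0r.
    by rewrite expgS tauM IHk -addn1 PoszD mulrDl mul1r addrC.
  rewrite -/(J_gen K i); lia.
(* As z is trivial in D and central, its cocycle is constantly 1, so [tau z] is the order of D,
   which is not 0. *)
have : tau z = @wsum D (fun=> 1%R) (fun=> 1%R : int).
  rewrite /tau; congr (wsum _ _); apply/funext => g; apply/z_inj/(mulgI (lift (J_proj z * g))).
  rewrite -cE expgz1 J_proj_class class_gen_word mul1g.
  exact/commute_sym/commute_J_center.
have /finite_seqP[r rE] := Dfin.
rewrite tau0 (@wsumE _ _ _ (undup r)) ?undup_uniq//; last first.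
  by move=> g; rewrite mem_undup => gr; have : [set: D]%classic g by []; rewrite rE /= (negbTE gr).
rewrite mulr1 big_const_seq count_predT iter_addr_0 => /eqP.
rewrite eq_sym -mulr_natl mulr1 pnatr_eq0 size_eq0 => /eqP r0.
have : [set: D]%classic 1 by [].
by rewrite rE /= -mem_undup r0.
Qed.

Lemma J_finite : finite_set [set: J]%classic.
Proof.
have [n n_gt0 zn] := J_center_finite_order.
pose F (gk : D * nat) : J := presented_class (J_rel K) (repr gk.1) * z ^+ gk.2.
apply: (@sub_finite_set _ _ (F @` ([set: D] `*` `I_n))%classic); last first.
  by apply: finite_image; apply: finite_setX => //; exact: finite_II.
move=> x _; have [m xE] : exists m, x = presented_class (J_rel K) (repr (J_proj x)) * expgz z m.
  by apply: J_proj_eq; rewrite J_proj_class presented_class_repr.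
have n_neq0 : n%:Z%R <> 0%R by lia.
exists (J_proj x, `|(m %% n%:Z)%Z|%N); first split=> //=.
  by have := ltz_mod m (introN eqP n_neq0); have := modz_ge0 m (introN eqP n_neq0); lia.
rewrite /F /= {2}xE; congr (_ * _).
have -> : z ^+ `|(m %% n%:Z)%Z| = expgz z (m %% n%:Z)%Z.
  by have := modz_ge0 m (introN eqP n_neq0); case: (m %% n)%Z.
rewrite [in RHS](divz_eq m n) [RHS]expgzD expgzM.
have -> : expgz z (m %/ n%:Z)%Z ^+ n = 1.
  case: (m %/ n)%Z => k /=; first by rewrite expgnAC zn expg1n.
  by rewrite expVgn expgnAC zn expg1n invg1.
by rewrite mul1g.
Qed.

End Transfer.

(** * The case of an infinite exponent *)

Section WordAction.
Variables (I : choiceType) (A : Type) (f : I * bool -> A -> A).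

Definition act_word (u : word I) (v : A) : A := foldr f v u.

Lemma act_word_cat u u' v : act_word (u ++ u') v = act_word u (act_word u' v).
Proof. exact: foldr_cat. Qed.

Hypothesis fK : forall i b v, f (i, b) (f (i, ~~ b) v) = v.

Lemma act_word_eq (R : word I -> word I -> Prop) :
  (forall u u', R u u' -> act_word u =1 act_word u') ->
  forall u u', word_eq R u u' -> act_word u =1 act_word u'.
Proof.
move=> RE u u'; elim=> {u u'}.
- by [].
- by move=> u u' _ E v.
- by move=> u u' w _ E _ E' v; rewrite E E'.
- by move=> u u' w w' _ E _ E' v; rewrite !act_word_cat E E'.
- by move=> i b v; exact: fK.
- exact: RE.
Qed.

(** [word_mulV] holds for every set of relations, in particular the empty one. *)
Lemma act_word_inv u v : act_word u (act_word (word_inv u) v) = v.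
Proof.
rewrite -act_word_cat.
by rewrite (act_word_eq (R := fun _ _ => False) _ (word_mulV _ u)).
Qed.

Lemma act_word_invl u v : act_word (word_inv u) (act_word u v) = v.
Proof.
rewrite -act_word_cat.
by rewrite (act_word_eq (R := fun _ _ => False) _ (word_mulVl _ u)).
Qed.

End WordAction.

Section InfiniteQuotient.
Variables (p : nat) (K : 'I_p -> option nat) (i j l : 'I_p).
Hypotheses (hK : forall t, ge2_or_infty (K t)) (Ki : K i = None).
Hypotheses (ji : j != i) (li : l != i) (lj : l != j).
Local Open Scope ring_scope.

(* The quotient of D killing the generators other than s_i, s_j, s_l is the free
   product of two cyclic groups; s_j and s_l can be mapped to rotations of the
   complex plane about the points 0 and 1, whose commutator is a translation. *)
Lemma Dgroup_infinite : infinite_set [set: Dgroup K]%classic.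
Proof.
(* For an infinite exponent any rotation order at least 2 would do; 2 is the default. *)
pose ord t : nat := if K t is Some k then k else 2.
have ord_gt1 t : (1 < ord t)%N by rewrite /ord; have := hK t; case: (K t).
have rex t : exists r : algC, (ord t).-primitive_root r.
  by have [r rP] := C_prim_root_exists (ltnW (ord_gt1 t)); exists r.
have [root rootP] := choice rex.
have root_neq1 t : root t != 1.
  apply/eqP => r1; have := rootP t; rewrite r1 => /prim_order_dvd /(_ 1%N).
  by rewrite expr1n eqxx dvdn1 => /eqP o1; have := ord_gt1 t; rewrite o1.
have root_neq0 t : root t != 0.
  have := prim_expr_order (rootP t); apply: contra_eq_neq => ->.
  by rewrite expr0n eqn0Ngt ltnW//= eq_sym oner_eq0.
pose ze t : algC := if (t == j) || (t == l) then root t else 1.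
have ze_neq0 t : ze t != 0 by rewrite /ze; case: ifP; rewrite ?oner_eq0.
have zeX t k : K t = Some k -> ze t ^+ k = 1.
  move=> Kt; rewrite /ze; case: ifP => _; last by rewrite expr1n.
  by have := prim_expr_order (rootP t); rewrite /ord Kt.
pose ctr t : algC := (t == l)%:R.
pose f0 (a : 'I_p * bool) (v : algC) : algC :=
  (if a.2 then (ze a.1)^-1 else ze a.1) * (v - ctr a.1) + ctr a.1.
have f0K t b v : f0 (t, b) (f0 (t, ~~ b) v) = v.
  rewrite /f0 /= addrK mulrA.
  by case: b; rewrite /= ?mulVf ?mulfV// mul1r subrK.
pose w1 := take i (gen_word p); pose w2 := drop i.+1 (gen_word p).
have wE : gen_word p = w1 ++ [:: (i, false)] ++ w2.
  by rewrite catA -take_gen_word cat_take_drop.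
(* s_i acts as w1^-1 w2^-1, the only choice making s_1 ... s_p trivial; its infinite exponent
   imposes no further condition. *)
pose f (a : 'I_p * bool) v :=
  if a.1 == i then act_word f0 (if a.2 then w2 ++ w1 else word_inv w1 ++ word_inv w2) v
  else f0 a v.
have fK t b v : f (t, b) (f (t, ~~ b) v) = v.
  rewrite /f /=; case: eqP => // _; case: b => /=; rewrite !act_word_cat.
    by rewrite !act_word_inv.
  by rewrite !act_word_invl.
have act_noti w v : i \notin [seq a.1 | a <- w] -> act_word f w v = act_word f0 w v.
  elim: w => //= a w IHw; rewrite inE negb_or => /andP[ai iw].
  by rewrite IHw// /f eq_sym (negbTE ai).
have uniq_gen : uniq [seq a.1 | a <- gen_word p].
  by rewrite -map_comp (eq_map (g := id)) ?map_id ?enum_uniq.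
have [iw1 iw2] : i \notin [seq a.1 | a <- w1] /\ i \notin [seq a.1 | a <- w2].
  move: uniq_gen; rewrite wE !map_cat cat_uniq /= => /and3P[_ iw12 /andP[iw2 _]].
  by split=> //; apply: contra iw12 => ->.
have actE u u' : word_eq (D_rel K) u u' -> act_word f u =1 act_word f u'.
  apply: act_word_eq => // {u u'} u u' [|t k Kt] v.
    rewrite wE !act_word_cat act_noti// (act_noti w2)//= /f /= eqxx act_word_cat.
    by rewrite act_word_invl// act_word_inv.
  have ti : t != i by apply: contra_eq_neq Kt => ->; rewrite Ki.
  rewrite /= -[RHS](subrK (ctr t)) -[_ - _]mul1r -(zeX _ _ Kt).
  elim: k {Kt} v => [|k IHk] v; first by rewrite expr0 mul1r subrK.
  rewrite -addn1 nseqD act_word_cat IHk /= /f /= (negbTE ti) /f0 /= addrK mulrA.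
  by rewrite exprD expr1.
pose cw : word 'I_p := [:: (j, false); (l, false); (j, true); (l, true)].
(* The commutator of the two rotations is translation by -d; d is nonzero since both roots differ
   from 1, so its powers are distinct. *)
pose d : algC := (1 - root l) * (1 - root j).
have d_neq0 : d != 0 by rewrite mulf_neq0// subr_eq0 eq_sym root_neq1.
have act_cw v : act_word f cw v = v - d.
  rewrite /= /f /= (negbTE ji) (negbTE li) /f0 /= /ze /ctr !eqxx orbT /=.
  rewrite [j == l]eq_sym (negbTE lj) /d.
  rewrite /= ?mulr0n ?mulr1n; move: (root_neq0 j) (root_neq0 l) => rj rl.
  by field; rewrite rj rl.
pose cwn n := flatten (nseq n cw).
have act_cwn n : act_word f (cwn n) 0 = - (d *+ n).
  elim: n => [|n IHn]; first by rewrite mulr0n oppr0.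
  by rewrite -[cwn n.+1]/(cw ++ cwn n) act_word_cat act_cw IHn mulrS opprD addrC.
have cwn_inj : injective (fun n => presented_class (D_rel K) (cwn n)).
  move=> m n /presented_classP /actE /(_ 0); rewrite !act_cwn => /oppr_inj.
  exact: mulrIn.
move=> /finite_seqP[r rE].
pose r' := [seq presented_class (D_rel K) (cwn n) | n <- iota 0 (size r).+1].
have : (size r' <= size r)%N.
  apply: uniq_leq_size; first by rewrite map_inj_uniq ?iota_uniq.
  by move=> g _; have : [set: Dgroup K]%classic g by []; rewrite rE.
by rewrite size_map size_iota ltnn.
Qed.

End InfiniteQuotient.

(** * Exponent sums of one generator modulo d *)

Section ExponentSum.
Variables (p : nat) (K : 'I_p -> option nat) (i : 'I_p) (d : int).
Local Open Scope ring_scope.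
Local Notation J := (Jgroup K).
Local Notation clsJ := (presented_class (J_rel K)).

Definition exponent_sum (u : word 'I_p) : int := \sum_(a <- u | a.1 == i) (-1) ^+ a.2.

Lemma exponent_sum_cat u v : exponent_sum (u ++ v) = exponent_sum u + exponent_sum v.
Proof. exact: big_cat. Qed.

Lemma exponent_sum_nseq j k :
  exponent_sum (nseq k (j, false)) = if j == i then k%:Z else 0.
Proof.
elim: k => [|k IHk]; first by rewrite /exponent_sum big_nil if_same.
rewrite -addn1 nseqD exponent_sum_cat IHk /exponent_sum /= big_cons big_nil /=.
by case: eqP => _; rewrite ?addr0// PoszD.
Qed.

Lemma exponent_sum_gen_word : exponent_sum (gen_word p) = 1.
Proof. by rewrite /exponent_sum big_map big_enum_cond big_pred1_eq. Qed.

(* With [d = 0] these are equalities of integers. *)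
Hypothesis dK : forall k, K i = Some k -> (d %| k%:Z)%Z.

Lemma dvdz_exponent_sum u v : word_eq (J_rel K) u v ->
  (d %| exponent_sum u - exponent_sum v)%Z.
Proof.
elim=> {u v}.
- by move=> u; rewrite subrr dvdz0.
- by move=> u v _; rewrite -rpredN opprB.
- by move=> u v w _ uv _ vw; have := rpredD uv vw; rewrite addrA subrK.
- move=> u u' v v' _ uu' _ vv'; rewrite !exponent_sum_cat opprD addrACA.
  exact: rpredD.
- move=> j b; rewrite (_ : _ - _ = 0) ?dvdz0// /exponent_sum !big_cons big_nil /=.
  by case: eqP; case: b.
- move=> u v [a b|j k Kj].
    by rewrite /exponent_sum !(perm_big _ (permEl (perm_rot _ _))) subrr dvdz0.
  rewrite exponent_sum_nseq /exponent_sum big_nil subr0; case: eqP => [ji|_]; last exact: dvdz0.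
  by apply: dK; rewrite -ji.
Qed.

(** Read on a chosen representative, hence meaningful only modulo d. *)
Definition J_exponent (x : J) : int := exponent_sum (repr x).

Lemma J_exponent_class u : (d %| J_exponent (clsJ u) - exponent_sum u)%Z.
Proof. exact/dvdz_exponent_sum/repr_presented_class. Qed.

Lemma J_exponentM x y : (d %| J_exponent (x * y)%g - (J_exponent x + J_exponent y))%Z.
Proof. by rewrite /J_exponent -exponent_sum_cat; exact: J_exponent_class. Qed.

Lemma J_exponent1 : (d %| J_exponent 1%g)%Z.
Proof. by have := J_exponent_class [::]; rewrite /exponent_sum big_nil subr0. Qed.

Lemma J_exponentV x : (d %| J_exponent x^-1%g + J_exponent x)%Z.
Proof.
have := rpredB J_exponent1 (J_exponentM x^-1%g x).
by rewrite mulVg subKr.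
Qed.

Lemma J_exponent_genX j n :
  (d %| J_exponent (J_gen K j ^+ n)%g - (if j == i then n%:Z else 0))%Z.
Proof. by rewrite -exponent_sum_nseq -[(_ ^+ n)%g]class_nseq; exact: J_exponent_class. Qed.

Lemma J_exponentX x n : (d %| J_exponent (x ^+ n)%g - J_exponent x * n%:Z)%Z.
Proof.
elim: n => [|n IHn]; first by rewrite mulr0 subr0; exact: J_exponent1.
have := rpredD (J_exponentM x (x ^+ n)%g) IHn; rewrite -expgS.
by congr (_ %| _)%Z; rewrite -addn1 PoszD; ring.
Qed.

Lemma J_exponent_center : (d %| J_exponent (J_center K) - 1)%Z.
Proof. by rewrite -exponent_sum_gen_word; exact: J_exponent_class. Qed.

Lemma dvdz_J_exponent_normal : normal_subgroup [set x : J | (d %| J_exponent x)%Z]%classic.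
Proof.
have dM x y : (d %| J_exponent x)%Z -> (d %| J_exponent y)%Z ->
    (d %| J_exponent (x * y)%g)%Z.
  by move=> dx dy; have := rpredD (J_exponentM x y) (rpredD dx dy); rewrite subrK.
split=> [|x y /= dx dy|x g /= dx]; first exact: J_exponent1.
  by apply: dM => //; have := rpredB (J_exponentV y) dy; rewrite addrK.
rewrite conjgE; have := rpredD (J_exponentM g^-1%g (x * g)%g)
  (rpredD (J_exponentM x g) (rpredD (J_exponentV g) dx)).
congr (_ %| _)%Z; ring.
Qed.

End ExponentSum.

(** * Torsion in J(K) *)

Section NormalClosure.
Variable G : groupType.
Local Open Scope group_scope.
Implicit Types (x y g : G) (H S : set G).

Lemma normal_closure_normal S : normal_subgroup (normal_closure S).
Proof.
split=> [|x y xS yS|x g xS] H nH; have [[H1 HV HJ] _] := nH; first exact: H1.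
  by apply: HV; [exact: xS|exact: yS].
by apply: HJ; exact: xS.
Qed.

Lemma normal_subgroupV H x : normal_subgroup H -> H x -> H x^-1.
Proof. by move=> [H1 HV _] Hx; rewrite -[_^-1]mul1g; apply: HV. Qed.

Lemma normal_subgroupM H x y : normal_subgroup H -> H x -> H y -> H (x * y).
Proof.
by move=> nH Hx Hy; rewrite -[y]invgK; case: (nH) => _ + _; apply=> //; exact: normal_subgroupV.
Qed.

Lemma normal_subgroup_expgz H x n : normal_subgroup H -> H x -> H (expgz x n).
Proof.
move=> nH Hx; apply: expgz_closed => //; first by case: nH.
  by move=> y y' Hy Hy'; exact: normal_subgroupM.
by move=> y Hy; exact: normal_subgroupV.
Qed.

End NormalClosure.

Section TorsionElements.
Variables (p : nat) (K : 'I_p -> option nat).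
Local Open Scope group_scope.
Local Notation J := (Jgroup K).
Local Notation D := (Dgroup K).
Local Notation z := (J_center K).

(** In D the relation s_1 ... s_p = 1 expresses s_i through the other generators. *)
Lemma D_ind_but_one (i : 'I_p) (A : set D) :
  A 1 -> (forall x y, A x -> A y -> A (x * y)) -> (forall x, A x -> A x^-1) ->
  (forall t, t != i -> A (D_gen K t)) -> forall x, A x.
Proof.
move=> A1 AM AV Agen; apply: presented_ind => // t.
have [->|/Agen//] := eqVneq t i.
pose w1 := take i (gen_word p); pose w2 := drop i.+1 (gen_word p).
have wE : gen_word p = w1 ++ [:: (i, false)] ++ w2.
  by rewrite catA -take_gen_word cat_take_drop.
have Aw w : all (fun a => (a.1 != i) && ~~ a.2) w -> A (presented_class (D_rel K) w).
  elim: w => //= -[s b] w IHw /andP[/andP[/= si /negbTE ->] {}/IHw Aw].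
  by rewrite -cat1s class_cat; apply: AM => //; exact: Agen.
have [Aw1 Aw2] : all (fun a => (a.1 != i) && ~~ a.2) w1 /\
    all (fun a => (a.1 != i) && ~~ a.2) w2.
  have : uniq [seq a.1 | a <- gen_word p].
    by rewrite -map_comp (eq_map (g := id)) ?map_id ?enum_uniq.
  have : all (fun a => ~~ a.2) (gen_word p) by rewrite all_map; apply/allP.
  rewrite wE !all_cat => /and3P[w1f _ w2f].
  rewrite !map_cat cat_uniq /= negb_or => /and3P[_ /andP[iw1 _] /andP[iw2 _]].
  split; apply/allP => a aw; apply/andP; split.
  - by apply: contra iw1 => /eqP <-; exact: map_f.
  - exact: (allP w1f).
  - by apply: contra iw2 => /eqP <-; exact: map_f.
  - exact: (allP w2f).
have := class_gen_word K; rewrite wE !class_cat class_gen => E1.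
suff -> : presented_gen (D_rel K) i = (presented_class (D_rel K) w1)^-1 *
    (presented_class (D_rel K) w2)^-1 by apply: AM; apply: AV; exact: Aw.
apply/(mulgI (presented_class (D_rel K) w1))/(mulIg (presented_class (D_rel K) w2)).
by rewrite mulVKg mulVg -mulgA.
Qed.

(** The image in D of the generator h other than s_i, or of h = 1 if there is none, generates D, so
    x = h^m z^n. As k_i is infinite, the exponent sum of s_i is a true integer: 0 on torsion
    elements and on h, 1 on z. Hence n = 0. *)
Lemma torsion_J_small (i : 'I_p) (x : J) : K i = None -> p <= 2 ->
  finite_order x -> exists j y g, cyc (J_gen K j) y /\ x = y ^ g.
Proof.
move=> Ki p_le2 [N N_gt0 xN].
have dK k : K i = Some k -> (0%R %| k%:Z)%Z by rewrite Ki.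
have [j [h [hj h0 hgen]]] : exists j h, [/\ cyc (J_gen K j) h, J_exponent i h = 0%R
    & forall t, t != i -> cyc (J_proj h) (D_gen K t)].
  have [[j ji]|noj] := pselect (exists j, j != i).
    exists j, (J_gen K j); split; first exact: cyc_id.
      have := J_exponent_genX dK j 1; rewrite expg1 (negbTE ji) subr0 dvd0z.
      by move/eqP.
    move=> t ti; have -> : t = j.
      apply/val_inj; have := ltn_ord t; have := ltn_ord j; have := ltn_ord i.
      by move: ti ji; rewrite -!val_eqE /=; lia.
    by rewrite J_proj_gen; exact: cyc_id.
  exists i, 1; split; first exact: cyc1.
    by apply/eqP; rewrite -dvd0z; exact: J_exponent1.
  by move=> t ti; case: noj; exists t.
have [m xm] : cyc (J_proj h) (J_proj x).
  apply: (@D_ind_but_one i) => //; [exact: cyc1| |].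
    by move=> ? ?; exact: cycM.
  by move=> ?; exact: cycV.
have [n xE] : exists n, x = expgz h m * expgz z n.
  by apply: J_proj_eq; rewrite xm J_proj_expgz.
exists j, (expgz h m), 1; rewrite conjg1; split.
  by apply: expgz_closed => //; [exact: cyc1| |]; move=> *; [exact: cycM|exact: cycV].
suff n0 : n = 0%R by rewrite {1}xE n0 mulg1.
have x0 : J_exponent i x = 0%R.
  have := J_exponentX dK x N; rewrite xN dvd0z.
  have := J_exponent1 dK; rewrite dvd0z => /eqP ->.
  by move: (J_exponent i x) => e /eqP; nia.
have hm0 : J_exponent i (expgz h m) = 0%R.
  have /(normal_subgroup_expgz m) := dvdz_J_exponent_normal dK.
  by move=> /(_ h); rewrite /= !dvd0z h0 eqxx => /(_ isT) /eqP.
have zn : J_exponent i (expgz z n) = n.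
  have z1 : J_exponent i z = 1%R.
    by have := J_exponent_center dK; rewrite dvd0z subr_eq0 => /eqP.
  have zX k : J_exponent i (z ^+ k) = k.
    by have := J_exponentX dK z k; rewrite z1 mul1r dvd0z subr_eq0 => /eqP.
  case: n {xE} => k; first exact: zX.
  have := J_exponentV dK (z ^+ k.+1); rewrite zX dvd0z addr_eq0 => /eqP /= ->.
  by rewrite NegzE.
have := J_exponentM dK (expgz h m) (expgz z n).
by rewrite -xE x0 hm0 zn sub0r add0r dvd0z oppr_eq0 => /eqP.
Qed.

Theorem torsion_conj_J_gen (x : J) : 0 < p -> (forall i, ge2_or_infty (K i)) ->
  infinite_set [set: J]%classic -> finite_order x -> x <> 1 ->
  exists i y g, cyc (J_gen K i) y /\ x = y ^ g.
Proof.
move=> p_gt0 hK Jinf xfin x_neq1.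
have [Dfin|Dinf] := pselect (finite_set [set: D]%classic); last first.
  exact: (torsion_J Dinf (Ordinal p_gt0)).
(* With D finite, finite exponents throughout would make J(K) finite. *)
have [[i Ki]|Kfin] := pselect (exists i, K i = None); last first.
  exfalso; apply/Jinf/(J_finite Dfin) => i.
  have := hK i; case Ki : (K i) => [k|]; last by case: Kfin; exists i.
  by move=> k_ge2; exists k => //; exact: ltnW.
have [p_le2|p_gt2] := leqP p 2; first exact: (torsion_J_small Ki p_le2 xfin).
exfalso.
have [j [l [ji li lj]]] : exists j l : 'I_p, [/\ j != i, l != i & l != j].
  pose o0 := Ordinal p_gt0; pose o1 := Ordinal (ltnW p_gt2); pose o2 := Ordinal p_gt2.
  have [i0|i0] := eqVneq i o0; first by exists o1, o2; rewrite i0.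
  have [i1|i1] := eqVneq i o1; first by exists o0, o2; rewrite i1.
  by exists o0, o1; rewrite ![_ == i]eq_sym.
exact: (Dgroup_infinite hK Ki ji li lj).
Qed.

End TorsionElements.

(** The elements whose exponent sum in s_i is divisible by k'_i form a normal subgroup containing
    every s_j^(k'_j). *)
Lemma gen_Jgroup_dvdn (p : nat) (K : 'I_p -> option nat) (K' : 'I_p -> nat) i m :
  dvd_or_infty (K' i) (K i) -> gen_Jgroup K K' (J_gen K i ^+ m)%g -> K' i %| m.
Proof.
move=> dvdK Hm.
have dK k : K i = Some k -> ((K' i)%:Z %| k%:Z)%Z by move=> Ki; move: dvdK; rewrite Ki.
have /Hm /= : normal_subgroup [set x : Jgroup K | ((K' i)%:Z %| J_exponent i x)%Z]%classic /\
    (range (fun t => (J_gen K t ^+ K' t)%g) `<=`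
     [set x : Jgroup K | ((K' i)%:Z %| J_exponent i x)%Z])%classic.
  split; first exact: dvdz_J_exponent_normal.
  move=> _ [t _ <-] /=.
  have := J_exponent_genX dK t (K' t); case: eqP => [ti|_].
    by rewrite ti => dv; have := rpredD dv (dvdzz (K' i)); rewrite subrK.
  by rewrite subr0.
move=> dm; have := rpredB dm (J_exponent_genX dK i m).
by rewrite eqxx subKr.
Qed.

Theorem corollary1p6 (p : nat) (K : 'I_p -> option nat) (K' : 'I_p -> nat)
    (hp : 1 <= p)
    (hK : forall i, ge2_or_infty (K i))
    (hK'_gt0 : forall i, 0 < K' i)
    (hK'_dvd : forall i, dvd_or_infty (K' i) (K i)) :
  infinite_set (gen_Jgroup K K') ->
  forall x : Jgroup K,
    (gen_Jgroup K K' x /\ finite_order x /\ x <> 1%g) <->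
    (reflection K K' x /\ finite_order x).
Proof.
move=> Hinf x; have nH := normal_closure_normal (range (fun i => J_gen K i ^+ K' i)%g).
have HJ g h : gen_Jgroup K K' g -> gen_Jgroup K K' (g ^ h)%g by case: nH => _ _; apply.
split=> [[Hx [xfin x_neq1]]|[[i [m [y [g [yE y_neq1 ->]]]]] xfin]]; last first.
  split; last by split=> // /eqP; rewrite conjg_eq1 => /eqP.
  apply: HJ; have Hs : gen_Jgroup K K' (J_gen K i ^+ K' i)%g.
    by move=> H [_ SH]; apply: SH; exists i.
  case: yE => ->; first exact: (normal_subgroup_expgz (Posz m) nH Hs).
  by apply: (normal_subgroupV nH); exact: (normal_subgroup_expgz (Posz m) nH Hs).
split=> //; have Jinf : infinite_set [set: Jgroup K]%classic.
  by apply: contra_not Hinf; apply: sub_finite_set.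
have [i [y [g [[n yE] xE]]]] := torsion_conj_J_gen hp hK Jinf xfin x_neq1.
have Hy : gen_Jgroup K K' y.
  by rewrite -(conjgK g y) -xE; exact: HJ.
have y_neq1 : y <> 1%g by move=> y1; apply: x_neq1; rewrite xE y1 conj1g.
(* Divisibility of the exponent by [K' i] turns a power of s_i into a power of s_i^(k'_i). *)
have pow k : gen_Jgroup K K' (J_gen K i ^+ k)%g ->
    (J_gen K i ^+ k = (J_gen K i ^+ K' i) ^+ (k %/ K' i))%g.
  by move=> /(gen_Jgroup_dvdn (hK'_dvd i)) dk; rewrite -expgnA mulnC divnK.
case: n yE => k yE.
  exists i, (k %/ K' i), y, g; split=> //; left; rewrite yE; apply: pow.
  by move: Hy; rewrite yE.
exists i, (k.+1 %/ K' i), y, g; split=> //; right; rewrite yE /= pow//.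
by rewrite -[X in gen_Jgroup _ _ X]invgK; apply: (normal_subgroupV nH); move: Hy; rewrite yE.
Qed.
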